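(* Let $d\ge2$ be an integer, $0\le F\le1$, and let $\rho_F=F\,\Psi_d+(1-F)\frac{\mathbb 1-\Psi_d}{d^2-1}$ be the isotropic state on $A\otimes B$ with $\dim A=\dim B=d$. For any integer $n\ge1$ and error tolerance $\varepsilon\in(0,1)$, the one-shot distillable entanglement under PPT operations of $\rho_F^{\otimes n}$ is $$E_{\mathrm{D},\mathrm{PPT}}^{(1),\varepsilon}(\rho_F^{\otimes n})=\log\max\ \lfloor1/\eta\rfloor$$ where the maximum is over real numbers $\eta,m_0,\dots,m_n$ subject to $$0\le m_i\le1\quad(i=0,1,\dots,n),$$ $$\sum_{i=0}^n\binom ni F^i(1-F)^{n-i}m_i\ge1-\varepsilon,$$ $$-\eta\le\sum_{i=0}^n x_{i,k}m_i\le\eta\quad(k=0,1,\dots,n),$$ with coefficients $$x_{i,k}=\frac1{d^n}\sum_{m=\max\{0,i+k-n\}}^{\min\{i,k\}}\binom km\binom{n-k}{i-m}(-1)^{i-m}(d-1)^{k-m}(d+1)^{n-k+m-i}.$$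
   Context: $\log$ is base $2$. For $k\in\mathbb N$, $k\ge1$, $\Psi_k=\frac1k\sum_{i,j=0}^{k-1}|ii\rangle\langle jj|$ denotes the $k$-dimensional maximally entangled state. The convention $0^0=1$ is used. PPT operations: a completely positive trace-preserving linear map $\Pi_{AB\to A'B'}$ is a PPT operation if its Choi–Jamiołkowski matrix $J_\Pi=\sum_{i,j,m,k}|i_Aj_B\rangle\langle m_Ak_B|\otimes\Pi(|i_Aj_B\rangle\langle m_Ak_B|)$ satisfies $J_\Pi^{T_{BB'}}\ge 0$, where $T_{BB'}$ is the partial transpose on $BB'$. The fidelity of distillation is $F_{\mathrm{PPT}}(\rho_{AB},k)=\max_{\Pi\in \mathrm{PPT}}\operatorname{Tr}\,\Pi_{AB\to A'B'}(\rho_{AB})\Psi_k$ with $\dim A'=\dim B'=k$, and $$E_{\mathrm{D},\mathrm{PPT}}^{(1),\varepsilon}(\rho_{AB})=\log\max\{k\in\mathbb N: F_{\mathrm{PPT}}(\rho_{AB},k)\ge 1-\varepsilon\}.$$ For $\rho_F^{\otimes n}$ the bipartition is $A^n:B^n$. *)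

(* Defs.v *)
From HB Require Import structures.
From mathcomp Require Export all_boot all_order all_algebra.
From mathcomp Require Export all_classical all_reals all_analysis.
From mathcomp.real_closed Require Export complex mxtens.

Set Implicit Arguments.
Unset Strict Implicit.
Unset Printing Implicit Defensive.

Export Order.TTheory GRing.Theory Num.Theory.

Local Open Scope classical_set_scope.
Local Open Scope complex_scope.
Local Open Scope ring_scope.
Local Open Scope sesquilinear_scope.

(* "max S" is a default value when the maximum is not attained, so statements
   about max_val should come with has_max. *)
Section Maximum.
Context {disp : Order.disp_t} {T : porderType disp}.

Definition is_max (S : set T) (x : T) : Prop := S x /\ ubound S x.

Definition has_max (S : set T) : Prop := exists x, is_max S x.

Definition max_val (x0 : T) (S : set T) : T := xget x0 [set x | is_max S x].

End Maximum.

Definition log2 {R : realType} (x : R) : R := ln x / ln 2.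

(* The composite of systems of dimensions m and n has dimension m * n, with
   |p>|q> the basis vector of index mxtens_index (p, q); accordingly *t is the
   tensor product of operators. *)
Section Operators.
Context {R : realType}.
Local Notation C := R[i].

(* On R[i], 0 <= z means that z is real and nonnegative; over the complex
   numbers the condition below therefore forces A to be Hermitian. *)
Definition psdmx n (A : 'M[C]_n) : Prop :=
  forall v : 'cV[C]_n, 0 <= (v ^t* *m A *m v) 0 0.

(* (id_r (x) Phi)(X) *)
Definition ampliation m m' (Phi : 'M[C]_m -> 'M[C]_m') r (X : 'M[C]_(r * m)) :
    'M[C]_(r * m') :=
  \sum_(p < r) \sum_(q < r)
    delta_mx p q *t
    Phi (\matrix_(x, y) X (mxtens_index (p, x)) (mxtens_index (q, y))).

Definition completely_positive m m' (Phi : 'M[C]_m -> 'M[C]_m') : Prop :=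
  forall r (X : 'M[C]_(r * m)), psdmx X -> psdmx (ampliation Phi X).

Definition trace_preserving m m' (Phi : 'M[C]_m -> 'M[C]_m') : Prop :=
  forall X : 'M[C]_m, \tr (Phi X) = \tr X.

Definition choi a b m' (Phi : 'M[C]_(a * b) -> 'M[C]_m') :
    'M[C]_((a * b) * m') :=
  \sum_(i < a) \sum_(j < b) \sum_(m < a) \sum_(k < b)
    let E := delta_mx (mxtens_index (i, j)) (mxtens_index (m, k)) in
    E *t Phi E.

(* Partial transpose on B and B' of an operator on A B A' B'. *)
Definition ptransposeBB' a b a' b' (J : 'M[C]_((a * b) * (a' * b'))) :
    'M[C]_((a * b) * (a' * b')) :=
  \matrix_(x, y)
    let: (xAB, xAB') := mxtens_unindex x in
    let: (yAB, yAB') := mxtens_unindex y in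
    let: (xA, xB) := mxtens_unindex xAB in
    let: (yA, yB) := mxtens_unindex yAB in
    let: (xA', xB') := mxtens_unindex xAB' in
    let: (yA', yB') := mxtens_unindex yAB' in
    J (mxtens_index (mxtens_index (xA, yB), mxtens_index (xA', yB')))
      (mxtens_index (mxtens_index (yA, xB), mxtens_index (yA', xB'))).

Definition ppt_operation a b a' b'
    (Pi : {linear 'M[C]_(a * b) -> 'M[C]_(a' * b')}) : Prop :=
  [/\ completely_positive Pi, trace_preserving Pi
    & psdmx (ptransposeBB' (choi Pi))].

Definition max_entangled k : 'M[C]_(k * k) :=
  k%:R^-1 *: \sum_(i < k) \sum_(j < k)
    delta_mx (mxtens_index (i, i)) (mxtens_index (j, j)).

(* The trace is real whenever rho is Hermitian. *)
Definition ppt_fidelities a b (rho : 'M[C]_(a * b)) k : set R :=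
  [set f | exists Pi : {linear 'M[C]_(a * b) -> 'M[C]_(k * k)},
     ppt_operation Pi /\ f = complex.Re (\tr (Pi rho *m max_entangled k))].

Definition F_PPT a b (rho : 'M[C]_(a * b)) k : R :=
  max_val 0 (ppt_fidelities rho k).

Definition ppt_distillable_dims (eps : R) a b (rho : 'M[C]_(a * b)) : set nat :=
  [set k | (1 <= k)%N /\ 1 - eps <= F_PPT rho k].

Definition E_D_PPT (eps : R) a b (rho : 'M[C]_(a * b)) : R :=
  log2 (max_val 0%N (ppt_distillable_dims eps rho))%:R.

Definition isotropic d (F : R) : 'M[C]_(d * d) :=
  F%:C *: max_entangled d
  + ((1 - F) / (d%:R ^+ 2 - 1))%:C *: (1%:M - max_entangled d).

(* The n-fold tensor power of an operator on A B, with its factors regrouped as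
   A^n : B^n. The standard bases of A^n and B^n are indexed by the functions
   u : {ffun 'I_n -> 'I_a}, resp. {ffun 'I_n -> 'I_b}, numbered by enum_val, and
     <u v| rho^n |u' v'> = \prod_s <u_s v_s| rho |u'_s v'_s>. *)
Definition tensor_power n a b (rho : 'M[C]_(a * b)) :
    'M[C]_(#|{ffun 'I_n -> 'I_a}| * #|{ffun 'I_n -> 'I_b}|) :=
  \matrix_(x, y)
    let u : {ffun 'I_n -> 'I_a} := enum_val (mxtens_unindex x).1 in
    let v : {ffun 'I_n -> 'I_b} := enum_val (mxtens_unindex x).2 in
    let u' : {ffun 'I_n -> 'I_a} := enum_val (mxtens_unindex y).1 in
    let v' : {ffun 'I_n -> 'I_b} := enum_val (mxtens_unindex y).2 in
    \prod_(s < n)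
      rho (mxtens_index (u s, v s)) (mxtens_index (u' s, v' s)).

End Operators.

(* x_{i,k}, for i, k <= n. Subtraction on nat is truncated: i + k - n is
   max{0, i + k - n}, and in the range of m all other differences are exact. *)
Definition iso_coef {R : realType} (d n i k : nat) : R :=
  (d%:R ^+ n)^-1 *
  \sum_((i + k - n)%N <= m < (minn i k).+1)
    ('C(k, m)%:R * 'C(n - k, i - m)%:R * (-1) ^+ (i - m)
     * (d%:R - 1) ^+ (k - m) * (d%:R + 1) ^+ (n - k + m - i)).

(* Main.v *)
(** For a projector P on AB, a PPT operation Pi gives the number tr (Pi P Psi_k),
    and positivity of the partially transposed Choi matrix, tested against
    Q (x) Sym_k and Q (x) Antisym_k, bounds tr (Pi Q^T_B Psi_k) by tr Q / k in
    absolute value for every projector Q.  Take for P the strings of n factors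
    Psi_d and 1 - Psi_d, and for Q the strings of n factors Sym_d and Antisym_d:
    the partial transpose maps each family into the span of the other, and
    averaging over the strings of equal weight turns these bounds into the
    linear program with eta = 1/k.

    Conversely a feasible m defines M = sum_i m_i P_i, where P_i is the sum of
    the strings of weight i, and the operation
    X |-> tr (M X) Psi_k + tr ((1 - M) X) (1 - Psi_k) / (k^2 - 1), which is PPT
    because its partially transposed Choi matrix is a nonnegative combination of
    the projectors Q (x) Sym_k and Q (x) Antisym_k.

    The dimensions k are bounded because the change of basis between the two
    families is invertible: m_i <= d^n eta. *)
From HB Require Import structures.
Require Import Defs.
From mathcomp Require Import zify ring lra.

Set Implicit Arguments.
Unset Strict Implicit.
Unset Printing Implicit Defensive.

Import numFieldNormedType.Exports.

Local Open Scope classical_set_scope.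
Local Open Scope complex_scope.
Local Open Scope ring_scope.
Local Open Scope sesquilinear_scope.

(** * Indices of tensor products *)

Lemma sum_mxtens (V : nmodType) m n (f : 'I_(m * n) -> V) :
  \sum_k f k = \sum_i \sum_j f (mxtens_index (i, j)).
Proof.
rewrite pair_big /= (reindex (@mxtens_index m n)) /=.
  by apply: eq_bigr => -[i j].
by exists (@mxtens_unindex m n) => ? _; rewrite (mxtens_indexK, mxtens_unindexK).
Qed.

Lemma matrix_tensP (T : Type) m n p q (A B : 'M[T]_(m * n, p * q)) :
  (forall i j k l, A (mxtens_index (i, j)) (mxtens_index (k, l)) =
                   B (mxtens_index (i, j)) (mxtens_index (k, l))) -> A = B.
Proof.
move=> AB; apply/matrixP => x y.
by case: (mxtens_indexP x) => i j; case: (mxtens_indexP y).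
Qed.

(** * Positive operators and completely positive maps *)

Section Operators.
Context {R : realType}.
Local Notation C := R[i].

Lemma adjmxM m n p (A : 'M[C]_(m, n)) (B : 'M[C]_(n, p)) :
  (A *m B)^t* = B^t* *m A^t*.
Proof. by rewrite trmx_mul map_mxM. Qed.

Lemma adjmxD m n (A B : 'M[C]_(m, n)) : (A + B)^t* = A^t* + B^t*.
Proof. by rewrite raddfD map_mxD. Qed.

Lemma adjmxN m n (A : 'M[C]_(m, n)) : (- A)^t* = - A^t*.
Proof. by rewrite raddfN map_mxN. Qed.

Lemma adjmxZ m n (c : C) (A : 'M[C]_(m, n)) : (c *: A)^t* = c^* *: A^t*.
Proof. by rewrite linearZ map_mxZ. Qed.

Lemma adjmx_tens m n p q (A : 'M[C]_(m, n)) (B : 'M[C]_(p, q)) :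
  (A *t B)^t* = A^t* *t B^t*.
Proof. by rewrite trmx_tens map_mxT. Qed.

Lemma adjmx1 n : (1%:M : 'M[C]_n)^t* = 1%:M.
Proof. by rewrite trmx1 map_mx1. Qed.

Lemma mxtrace_tens m n (A : 'M[C]_m) (B : 'M[C]_n) :
  \tr (A *t B) = \tr A * \tr B.
Proof.
rewrite /mxtrace sum_mxtens big_distrlr /=.
by do 2![apply: eq_bigr => ? _]; rewrite tensmxE.
Qed.

Definition orthoproj n (P : 'M[C]_n) := P^t* = P /\ P *m P = P.

Lemma orthoproj1 n : orthoproj (1%:M : 'M[C]_n).
Proof. by split; rewrite ?adjmx1 ?mul1mx. Qed.

Lemma orthoprojB n (P : 'M[C]_n) : orthoproj P -> orthoproj (1%:M - P).
Proof.
case=> hP iP; split; first by rewrite adjmxD adjmxN adjmx1 hP.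
by rewrite mulmxBl mul1mx mulmxBr mulmx1 iP subrr subr0.
Qed.

Lemma orthoproj_tens m n (P : 'M[C]_m) (Q : 'M[C]_n) :
  orthoproj P -> orthoproj Q -> orthoproj (P *t Q).
Proof.
by move=> [hP iP] [hQ iQ]; split;
  rewrite ?adjmx_tens ?tensmx_mul ?hP ?hQ ?iP ?iQ.
Qed.

Lemma psdmx0 n : psdmx (0 : 'M[C]_n).
Proof. by move=> v; rewrite mulmx0 mul0mx mxE. Qed.

Lemma psdmxD n (A B : 'M[C]_n) : psdmx A -> psdmx B -> psdmx (A + B).
Proof. by move=> pA pB v; rewrite mulmxDr mulmxDl mxE addr_ge0. Qed.

Lemma psdmxZ n (c : C) (A : 'M[C]_n) : 0 <= c -> psdmx A -> psdmx (c *: A).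
Proof. by move=> c0 pA v; rewrite -scalemxAr -scalemxAl mxE mulr_ge0. Qed.

Lemma psdmx_sum n (I : Type) (r : seq I) (P : pred I) (A : I -> 'M[C]_n) :
  (forall i, P i -> psdmx (A i)) -> psdmx (\sum_(i <- r | P i) A i).
Proof.
move=> pA; elim: r => [|i r IHr]; first by rewrite big_nil; exact: psdmx0.
by rewrite big_cons; case: ifP => Pi; [exact: psdmxD (pA i Pi) IHr|exact: IHr].
Qed.

Lemma psdmx_congr m n (A : 'M[C]_m) (B : 'M[C]_(n, m)) :
  psdmx A -> psdmx (B *m A *m B^t*).
Proof. by move=> pA v; have := pA (B^t* *m v); rewrite adjmxM trmxCK !mulmxA. Qed.

Lemma psdmx1 n : psdmx (1%:M : 'M[C]_n).
Proof.
move=> v; rewrite mulmx1 mxE sumr_ge0 // => i _.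
by rewrite !mxE mulrC mul_conjC_ge0.
Qed.

Lemma psdmx_orthoproj n (P : 'M[C]_n) : orthoproj P -> psdmx P.
Proof.
move=> [hP iP]; rewrite -iP -{2}hP -[P in P *m _]mulmx1.
exact/psdmx_congr/psdmx1.
Qed.

Lemma psdmx_trace n (A : 'M[C]_n) : psdmx A -> 0 <= \tr A.
Proof.
move=> pA; apply: sumr_ge0 => i _.
have := pA (delta_mx i 0).
suff -> : ((delta_mx i 0 : 'cV[C]_n)^t* *m A *m (delta_mx i 0 : 'cV[C]_n)) 0 0 = A i i by [].
by rewrite trmx_delta map_delta_mx -rowE -colE !mxE.
Qed.

(** Idempotence and cyclicity turn tr (A P) into the trace of the congruence P A P^*. *)
Lemma psdmx_trace_orthoproj n (A P : 'M[C]_n) :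
  psdmx A -> orthoproj P -> 0 <= \tr (A *m P).
Proof.
move=> pA [hP iP]; rewrite -iP mulmxA mxtrace_mulC mulmxA -{2}hP.
exact/psdmx_trace/psdmx_congr.
Qed.

Lemma ampliationE m m' (Phi : 'M[C]_m -> 'M[C]_m') r (X : 'M[C]_(r * m))
    p q (x y : 'I_m') :
  ampliation Phi X (mxtens_index (p, x)) (mxtens_index (q, y)) =
  Phi (\matrix_(a, b) X (mxtens_index (p, a)) (mxtens_index (q, b))) x y.
Proof.
rewrite /ampliation summxE (bigD1 p) //= [X in _ + X]big1 ?addr0; last first.
  move=> p' pp'; rewrite summxE big1 // => q' _.
  by rewrite tensmxE mxE eq_sym (negPf pp') mul0r.
rewrite summxE (bigD1 q) //= [X in _ + X]big1 ?addr0; last first.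
  by move=> q' qq'; rewrite tensmxE mxE [q == _]eq_sym (negPf qq') andbF mul0r.
by rewrite tensmxE mxE !eqxx mul1r.
Qed.

(** The ampliation is the congruence by 1 (x) K. *)
Lemma completely_positive_kraus m m' (K : 'M[C]_(m', m)) :
  completely_positive (fun X => K *m X *m K^t*).
Proof.
move=> r X pX.
have -> : ampliation (fun X => K *m X *m K^t*) X =
          (1%:M *t K) *m X *m (1%:M *t K)^t*; last exact: psdmx_congr.
rewrite adjmx_tens adjmx1; apply: matrix_tensP => p x q y.
rewrite ampliationE [LHS]mxE [RHS]mxE sum_mxtens (bigD1 q) //=.
rewrite [X in _ = _ + X]big1 ?addr0; last first.
  move=> q' qq'; rewrite big1 // => z _.
  by rewrite tensmxE [1%:M q' q]mxE (negPf qq') mul0r mulr0.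
apply: eq_bigr => z _; rewrite tensmxE [1%:M q q]mxE eqxx mul1r; congr (_ * _).
rewrite [LHS]mxE [RHS]mxE sum_mxtens (bigD1 p) //=.
rewrite [X in _ = _ + X]big1 ?addr0; last first.
  move=> p' pp'; rewrite big1 // => w _.
  by rewrite tensmxE [1%:M p p']mxE eq_sym (negPf pp') !mul0r.
by apply: eq_bigr => w _; rewrite tensmxE !mxE eqxx mul1r.
Qed.

Lemma completely_positiveD m m' (Phi Psi : 'M[C]_m -> 'M[C]_m') :
  completely_positive Phi -> completely_positive Psi ->
  completely_positive (fun X => Phi X + Psi X).
Proof.
move=> pPhi pPsi r X pX.
have -> : ampliation (fun X => Phi X + Psi X) X =
          ampliation Phi X + ampliation Psi X.
  by apply: matrix_tensP => *; rewrite [RHS]mxE !ampliationE mxE.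
by apply: psdmxD; [apply: pPhi | apply: pPsi].
Qed.

Lemma completely_positiveZ m m' (c : C) (Phi : 'M[C]_m -> 'M[C]_m') :
  0 <= c -> completely_positive Phi ->
  completely_positive (fun X => c *: Phi X).
Proof.
move=> c0 pPhi r X pX.
have -> : ampliation (fun X => c *: Phi X) X = c *: ampliation Phi X.
  by apply: matrix_tensP => *; rewrite [RHS]mxE !ampliationE mxE.
by apply: psdmxZ => //; apply: pPhi.
Qed.

Lemma completely_positive_sum m m' (I : Type) (r : seq I)
    (Phi : I -> 'M[C]_m -> 'M[C]_m') :
  (forall i, completely_positive (Phi i)) ->
  completely_positive (fun X => \sum_(i <- r) Phi i X).
Proof.
move=> pPhi; elim: r => [|i r IHr] s X pX.
  suff -> : ampliation (fun X => \sum_(i <- [::]) Phi i X) X = 0 by exact: psdmx0.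
  by apply: matrix_tensP => *; rewrite ampliationE big_nil !mxE.
have -> : ampliation (fun X => \sum_(i <- i :: r) Phi i X) X =
          ampliation (fun X => Phi i X + \sum_(i <- r) Phi i X) X.
  by apply: matrix_tensP => *; rewrite !ampliationE big_cons.
exact: (completely_positiveD (pPhi i) IHr pX).
Qed.

Lemma completely_positive_ext m m' (Phi Psi : 'M[C]_m -> 'M[C]_m') :
  Phi =1 Psi -> completely_positive Phi -> completely_positive Psi.
Proof. by move=> /funext ->. Qed.

(* The Kraus operators are the N |w><z| P. *)
Lemma completely_positive_measure_prepare m m' (P : 'M[C]_m) (N : 'M[C]_m') :
  orthoproj P -> orthoproj N -> completely_positive (fun X => \tr (P *m X) *: N).
Proof.
move=> [hP iP] [hN iN].
pose K w z : 'M[C]_(m', m) := N *m delta_mx w z *m P.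
have Phi_kraus X : \sum_w \sum_z K w z *m X *m (K w z)^t* = \tr (P *m X) *: N.
  have Kraus w z : K w z *m X *m (K w z)^t* =
      (P *m X *m P) z z *: (N *m delta_mx w w *m N).
    rewrite /K !adjmxM hN hP trmx_delta map_delta_mx -!mulmxA.
    rewrite -(mul_delta_mx (0 : 'I_1) w z) -(mul_delta_mx (0 : 'I_1) z w) -!mulmxA.
    rewrite (mulmxA _ P) (mulmxA _ X) (mulmxA _ P) (mulmxA _ (delta_mx z 0)).
    rewrite [X in _ *m (_ *m (X *m _))](_ : _ = ((P *m X *m P) z z)%:M); last first.
      by apply/matrixP => a b; rewrite !ord1 -rowE -!row_mul -colE !mxE.
    by rewrite mul_scalar_mx -!scalemxAr -(mul_delta_mx (0 : 'I_1) w w) -!mulmxA.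
  under eq_bigr => w _ do under eq_bigr => z _ do rewrite Kraus.
  under eq_bigr => w _ do rewrite -scaler_suml.
  rewrite -scaler_sumr -mulmx_suml -mulmx_sumr -mx1_sum_delta mulmx1 iN.
  by congr (_ *: _); rewrite [LHS](mxtrace_mulC (P *m X) P) mulmxA iP.
apply: (completely_positive_ext Phi_kraus).
by apply: completely_positive_sum => w; apply: completely_positive_sum => z;
  exact: completely_positive_kraus.
Qed.

End Operators.
(** * The coefficients of the linear program *)

Section BinaryStrings.
Context {n : nat}.
Implicit Types s t : {ffun 'I_n -> bool}.

(** The value is an ordinal so that it can index the variables of the linear program; a string has
    at most n true letters, so [inord] never falls back on its default. *)
Definition weight s : 'I_n.+1 := inord (\sum_j s j).

Lemma weightE s : weight s = (\sum_j s j)%N :> nat.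
Proof.
by rewrite inordK // ltnS -[leqRHS]card_ord -sum1_card leq_sum // => j _; case: (s j).
Qed.

Lemma sum_weight (V : nmodType) (f : {ffun 'I_n -> bool} -> V) :
  \sum_s f s = \sum_(i < n.+1) \sum_(s | weight s == i) f s.
Proof. by rewrite (partition_big weight predT). Qed.

Lemma prod_weight (A : comPzRingType) (f : bool -> A) s :
  \prod_j f (s j) = f true ^+ weight s * f false ^+ (n - weight s).
Proof.
have -> : (n - weight s = \sum_j ~~ s j)%N.
  apply/eqP; rewrite -(eqn_add2l (weight s)) subnKC; last by rewrite -ltnS ltn_ord.
  rewrite weightE -big_split /= -[X in X == _]card_ord -sum1_card.
  by apply/eqP/eq_bigr => j _; case: (s j).
rewrite weightE -!prodrXr -big_split /=; apply: eq_bigr => j _.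
by case: (s j); rewrite ?mulr1 ?mul1r.
Qed.

Variable K : idomainType.

Lemma coef_linear_exp (a b : K) k i :
  ((a%:P + b *: 'X) ^+ k)`_i = a ^+ (k - i) * b ^+ i *+ 'C(k, i).
Proof.
rewrite exprDn coef_sum.
under eq_bigr => j _.
  rewrite coefMn exprZn -rmorphXn /= -scalerAr coefZ coefCM coefXn mulrA.
  rewrite [_ ^+ j * _]mulrC mulr_natr.
  over.
have [ki|ik] := ltnP k i.
  rewrite bin_small // mulr0n big1 // => j _.
  by rewrite gtn_eqF ?mulr0n ?mul0rn // (leq_ltn_trans _ ki) // -ltnS.
rewrite (bigD1 (Ordinal (ik : i < k.+1)%N)) //= eqxx mulr1n big1 ?addr0 // => j ji.
by rewrite [i == j]eq_sym; have /negPf -> : (j : nat) != i by []; rewrite mulr0n mul0rn.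
Qed.

Variable c : bool -> bool -> K.

(** Generating function: the sum is the coefficient of X^i in the product over j of [c false (t j)]
    + [c true (t j)] X, since expanding that product picks a string s and the power X^(weight s).
    Grouping the factors by the letter of t leaves two binomial powers; m counts the positions where
    s and t are both true. *)
Lemma sum_prod_weight t (i : 'I_n.+1) :
  \sum_(s | weight s == i) \prod_j c (s j) (t j) =
  \sum_(m < i.+1)
    (c false true ^+ (weight t - m) * c true true ^+ m *+ 'C(weight t, m)) *
    (c false false ^+ (n - weight t - (i - m)) * c true false ^+ (i - m)
       *+ 'C(n - weight t, i - m)).
Proof.
pose p b := (c false b)%:P + c true b *: 'X.
have -> : \sum_(s | weight s == i) \prod_j c (s j) (t j) =
          (\prod_j p (t j))`_i.
  have -> : \prod_j p (t j) =
      \prod_j \sum_(b : bool) (c b (t j)) *: 'X^b.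
    apply: eq_bigr => j _; rewrite big_bool /= /p expr1 expr0 addrC.
    by rewrite -alg_polyC.
  rewrite bigA_distr_bigA coef_sum big_mkcond /=; apply: eq_bigr => s _.
  rewrite scaler_prod coefZ prodrXr coefXn -val_eqE eq_sym /= weightE.
  by case: eqP => _; rewrite ?mulr1 ?mulr0.
rewrite prod_weight coefM; apply: eq_bigr => m _.
by rewrite !coef_linear_exp.
Qed.

End BinaryStrings.

(** With c = 1 and t constantly true, every string contributes 1 to [sum_prod_weight], and only m =
    i survives on the right. *)
Lemma card_weight n (i : 'I_n.+1) :
  #|[pred s : {ffun 'I_n -> bool} | weight s == i]| = 'C(n, i).
Proof.
apply/eqP; rewrite -(eqr_nat int) -sum1_card natr_sum; apply/eqP.
pose c : bool -> bool -> int := fun _ _ => 1.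
pose t := [ffun j : 'I_n => true].
have wt : weight t = n :> nat.
  by rewrite weightE -[RHS]card_ord -sum1_card; apply: eq_bigr => j _; rewrite ffunE.
transitivity (\sum_(s | weight s == i) \prod_j c (s j) (t j)).
  by apply: eq_bigr => s _; rewrite big1.
rewrite sum_prod_weight wt /c.
rewrite big_ord_recr /= subnn subnn bin0 !expr1n !mulr1 big1 ?add0r //.
by move=> m _; rewrite bin0n subn_eq0 leqNgt ltn_ord /= mulr0n mulr0.
Qed.

Lemma weight_surj n (i : 'I_n.+1) : exists s, weight s = i.
Proof.
have : (0 < 'C(n, i))%N by rewrite bin_gt0 -ltnS.
by rewrite -card_weight => /card_gt0P[s]; rewrite inE => /eqP; exists s.
Qed.

Section Coefficients.
Context {R : realType}.
Variables d n : nat.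
Implicit Types s t : {ffun 'I_n -> bool}.
Hypothesis d_gt1 : (1 < d)%N.
Let dn0 : d%:R != 0 :> R. Proof. by rewrite pnatr_eq0 -lt0n ltnW. Qed.

(* Psi_d (true) and 1 - Psi_d (false) have partial transposes
   \sum_b transpose_coef _ b *: (b ? Sym : Antisym), where Sym and Antisym are
   the projectors on the symmetric and antisymmetric subspaces, and
   transpose_coef_inv is the inverse change of basis. *)
Definition transpose_coef (a b : bool) : R :=
  d%:R^-1 * if a then (-1) ^+ (~~ b) else if b then d%:R - 1 else d%:R + 1.

Definition transpose_coef_inv (b a : bool) : R :=
  2^-1 * if a then 1 + (-1) ^+ (~~ b) * d%:R else 1.

Lemma transpose_coefK a a' :
  \sum_b transpose_coef_inv b a' * transpose_coef a b = (a == a')%:R.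
Proof.
by case: a; case: a'; rewrite big_bool /transpose_coef /transpose_coef_inv /=
  ?expr0 ?expr1; field.
Qed.

(** Psi_d and its complement sum to the identity, which the partial transpose fixes and which is
    also Sym + Antisym. *)
Lemma sum_transpose_coef b : \sum_a transpose_coef a b = 1.
Proof. by case: b; rewrite big_bool /transpose_coef /= ?expr0 ?expr1; field. Qed.

(** The sum is d for Psi_d and 1 for its complement; the n-fold product of this bound is the source
    of the factor d^n in the bound on m. *)
Lemma sum_transpose_coef_inv_le a : \sum_b `|transpose_coef_inv b a| <= d%:R.
Proof.
have d1 : 1 <= d%:R :> R by rewrite ler1n ltnW.
rewrite big_bool /transpose_coef_inv /=; case: a; rewrite ?expr0 ?expr1.
  by rewrite ger0_norm ?ler0_norm; lra.
by rewrite ger0_norm; lra.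
Qed.

(** Pulling d^-1 out of each of the n factors leaves the sum computed by [sum_prod_weight]. So
    [iso_coef] is the coefficient, on the Sym/Antisym string t, of the partial transpose of the sum
    of all isotropic strings of weight i, and it depends on t only through its weight. *)
Lemma iso_coefE t (i : 'I_n.+1) :
  iso_coef d n i (weight t) =
  \sum_(s | weight s == i) \prod_j transpose_coef (s j) (t j).
Proof.
pose c (a b : bool) : R :=
  if a then (-1) ^+ (~~ b) else if b then d%:R - 1 else d%:R + 1.
under eq_bigr => s _.
  rewrite big_split /= prodr_const card_ord exprVn -[\prod_j _]/(\prod_j c (s j) (t j)).
  over.
rewrite -big_distrr /= sum_prod_weight /iso_coef; congr (_ * _).
have: (i <= n)%N by rewrite -ltnS.
have: (weight t <= n)%N by rewrite -ltnS.
move: (nat_of_ord (weight t)) (nat_of_ord i) => k {}i kn iin.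
rewrite -(big_mkord xpredT (fun m =>
  (c false true ^+ (k - m) * c true true ^+ m *+ 'C(k, m)) *
    (c false false ^+ (n - k - (i - m)) * c true false ^+ (i - m)
       *+ 'C(n - k, i - m)))).
(* Below i + k - n the factor ['C(n - k, i - m)] vanishes; above min(i, k), where m > k, the factor
   ['C(k, m)] does. *)
rewrite [RHS](big_cat_nat (n := i + k - n)) //=; last by lia.
rewrite [X in _ = X + _]big_nat_cond [X in _ = X + _]big1 ?add0r; last first.
  by move=> m mik; rewrite (@bin_small (n - k)) ?mulr0n ?mulr0 //; lia.
rewrite [RHS](big_cat_nat (n := (minn i k).+1)) //=; [|lia|lia].
rewrite [X in _ = _ + X]big_nat_cond [X in _ = _ + X]big1 ?addr0; last first.
  by move=> m mik; rewrite (@bin_small k) ?mulr0n ?mul0r //; lia.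
rewrite [LHS]big_nat_cond [RHS]big_nat_cond; apply: eq_bigr => m mik.
rewrite /c /= expr0 expr1 expr1n mulr1 -(mulr_natr (_ ^+ (k - m))) -(mulr_natr (_ * _)).
have -> : (n - k + m - i = n - k - (i - m))%N by lia.
by move: 'C(k, m)%:R 'C(n - k, i - m)%:R => x y; ring.
Qed.

(** When the values attached to strings depend only on the weight, the coefficient on t after
    partial transposition is exactly the form that the linear program constrains at k =
    [weight t]. *)
Lemma sum_weight_iso_coef (m : 'I_n.+1 -> R) t :
  \sum_(s : {ffun 'I_n -> bool}) (\prod_j transpose_coef (s j) (t j)) * m (weight s) =
  \sum_(i < n.+1) iso_coef d n i (weight t) * m i.
Proof.
rewrite sum_weight; apply: eq_bigr => i _; rewrite iso_coefE mulr_suml.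
by apply: eq_bigr => s /eqP ->.
Qed.

Lemma sum_prod_transpose_coef t :
  \sum_(s : {ffun 'I_n -> bool}) \prod_j transpose_coef (s j) (t j) = 1.
Proof.
rewrite -(bigA_distr_bigA (fun j a => transpose_coef a (t j))) /=.
by rewrite big1 // => j _; rewrite sum_transpose_coef.
Qed.

Lemma sum_iso_coef (k : 'I_n.+1) : \sum_(i < n.+1) iso_coef d n i k = 1 :> R.
Proof.
have [t <-] := weight_surj k.
rewrite -(sum_prod_transpose_coef t) sum_weight.
by apply: eq_bigr => i _; rewrite iso_coefE.
Qed.

Definition weight_average (f : {ffun 'I_n -> bool} -> R) (i : 'I_n.+1) : R :=
  'C(n, i)%:R^-1 * \sum_(s | weight s == i) f s.

Lemma binE_neq0 (i : 'I_n.+1) : 'C(n, i)%:R != 0 :> R.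
Proof. by rewrite pnatr_eq0 -lt0n bin_gt0 -ltnS. Qed.

Lemma weight_averageE f (i : 'I_n.+1) :
  'C(n, i)%:R * weight_average f i = \sum_(s | weight s == i) f s.
Proof. by rewrite mulVKf // binE_neq0. Qed.

Lemma weight_average_bounds f (i : 'I_n.+1) a b :
  (forall s, a <= f s <= b) -> a <= weight_average f i <= b.
Proof.
move=> fab; have C0 : 0 < 'C(n, i)%:R :> R by rewrite lt0r binE_neq0 ler0n.
rewrite -(ler_pM2l C0 a) -(ler_pM2l C0 _ b) weight_averageE.
rewrite -card_weight -sum1_card natr_sum !mulr_suml.
by apply/andP; split; apply: ler_sum => s _; rewrite mul1r; case/andP: (fab s).
Qed.

(** Averaging over weight classes commutes with the change of basis: the sum of the coefficients of
    s over all t of weight k depends on s only through its weight, and double counting the pairs (s,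
    t) of weights i and k identifies it with [iso_coef] up to binomials. *)
Lemma iso_coef_weight_average f (k : 'I_n.+1) :
  \sum_(i < n.+1) iso_coef d n i k * weight_average f i =
  weight_average (fun t =>
    \sum_(s : {ffun 'I_n -> bool}) (\prod_j transpose_coef (s j) (t j)) * f s) k.
Proof.
apply: (mulfI (binE_neq0 k)); rewrite weight_averageE exchange_big sum_weight /=.
rewrite mulr_sumr; apply: eq_bigr => i _.
pose W s := \sum_(t | weight t == k) \prod_j transpose_coef (s j) (t j).
under eq_bigr => s _ do rewrite -mulr_suml -/(W s).
have Wwt s s' : weight s = weight s' -> W s = W s'.
  by rewrite /W !(sum_prod_weight (fun a b => transpose_coef b a)) => ->.
have [s0 s0i] := weight_surj i.
have WC : 'C(n, i)%:R * W s0 = 'C(n, k)%:R * iso_coef d n i k.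
  transitivity (\sum_(s | weight s == i) W s).
    rewrite -card_weight -sum1_card natr_sum mulr_suml.
    by apply: eq_bigr => s /eqP si; rewrite mul1r; apply: Wwt; rewrite s0i si.
  rewrite exchange_big -card_weight -sum1_card natr_sum mulr_suml /=.
  by apply: eq_bigr => t /eqP <-; rewrite mul1r iso_coefE.
rewrite mulrA -WC -mulrA mulrCA weight_averageE mulr_sumr.
by apply: eq_bigr => s /eqP si; rewrite (Wwt s0 s) // s0i si.
Qed.

Lemma sum_weight_binomial (F : R) (m : 'I_n.+1 -> R) :
  \sum_(s : {ffun 'I_n -> bool}) F ^+ weight s * (1 - F) ^+ (n - weight s) * m (weight s) =
  \sum_(i < n.+1) 'C(n, i)%:R * F ^+ i * (1 - F) ^+ (n - i) * m i.
Proof.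
rewrite sum_weight; apply: eq_bigr => i _.
rewrite -card_weight -sum1_card natr_sum !mulr_suml.
by apply: eq_bigr => s /eqP ->; rewrite mul1r.
Qed.

Lemma sum_binomial1 (F : R) :
  \sum_(i < n.+1) 'C(n, i)%:R * F ^+ i * (1 - F) ^+ (n - i) = 1 :> R.
Proof.
rewrite -[RHS](expr1n _ n) -[X in X ^+ n](subrK F) exprDn.
by apply: eq_bigr => i _; rewrite -mulr_natr; ring.
Qed.

(** The inverse change of basis recovers m from the constrained forms: each form is at most eta in
    absolute value, and the absolute inverse coefficients sum to at most d per factor. *)
Lemma le_exp_of_iso_coef (m : 'I_n.+1 -> R) (eta : R) :
  (forall k : 'I_n.+1, `|\sum_(i < n.+1) iso_coef d n i k * m i| <= eta) ->
  forall s, m (weight s) <= d%:R ^+ n * eta.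
Proof.
move=> meta s.
have eta0 : 0 <= eta by apply: le_trans (meta ord0); exact: normr_ge0.
have -> : m (weight s) =
    \sum_(t : {ffun 'I_n -> bool}) (\prod_j transpose_coef_inv (t j) (s j)) *
    \sum_(s' : {ffun 'I_n -> bool}) (\prod_j transpose_coef (s' j) (t j)) * m (weight s').
  under eq_bigr => t _ do rewrite mulr_sumr.
  rewrite exchange_big /= (bigD1 s) //= [X in _ + X]big1 ?addr0.
    under eq_bigr => t _ do rewrite mulrA -big_split /=.
    rewrite -mulr_suml -(bigA_distr_bigA (fun j b =>
      transpose_coef_inv b (s j) * transpose_coef (s j) b)) /=.
    by rewrite big1 ?mul1r // => j _; rewrite transpose_coefK eqxx.
  move=> s' ss'; under eq_bigr => t _ do rewrite mulrA -big_split /=.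
  rewrite -mulr_suml -(bigA_distr_bigA (fun j b =>
    transpose_coef_inv b (s j) * transpose_coef (s' j) b)) /=.
  (* A string s' other than s differs from it at some j, where the one-site inversion contributes
     the factor 0. *)
  have [j sj] : exists j, s' j != s j.
    apply/existsP; apply: contraNT ss'; rewrite negb_exists => /forallP ss'.
    by apply/eqP/ffunP => j; have := ss' j; rewrite negbK => /eqP.
  by rewrite (bigD1 j) //= transpose_coefK (negPf sj) !mul0r.
apply: (le_trans (ler_norm _)); apply: (le_trans (ler_norm_sum _ _ _)).
apply: (@le_trans _ _
  (\sum_(t : {ffun 'I_n -> bool}) (\prod_j `|transpose_coef_inv (t j) (s j)|) * eta)).
  by apply: ler_sum => t _; rewrite normrM normr_prod sum_weight_iso_coef
    ler_wpM2l // prodr_ge0.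
rewrite -mulr_suml ler_wpM2r // -(bigA_distr_bigA (fun j b =>
  `|transpose_coef_inv b (s j)|)) /=.
rewrite -[X in _ <= _ ^+ X]card_ord -prodr_const; apply: ler_prod => j _.
by rewrite sumr_ge0 ?sum_transpose_coef_inv_le.
Qed.

End Coefficients.
(** * Partial transposes *)

Section PartialTranspose.
Context {R : realType}.
Local Notation C := R[i].

Definition ptrans a b (X : 'M[C]_(a * b)) : 'M[C]_(a * b) :=
  \matrix_(x, y)
    X (mxtens_index ((mxtens_unindex x).1, (mxtens_unindex y).2))
      (mxtens_index ((mxtens_unindex y).1, (mxtens_unindex x).2)).

Lemma ptransE a b (X : 'M[C]_(a * b)) i j k l :
  ptrans X (mxtens_index (i, j)) (mxtens_index (k, l)) =
  X (mxtens_index (i, l)) (mxtens_index (k, j)).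
Proof. by rewrite mxE !mxtens_indexK. Qed.

Lemma ptrans_is_linear a b : linear (@ptrans a b).
Proof. by move=> c X Y; apply/matrixP => x y; rewrite !mxE. Qed.

HB.instance Definition _ a b :=
  GRing.isLinear.Build C _ _ _ (@ptrans a b) (@ptrans_is_linear a b).

Lemma ptransK a b : involutive (@ptrans a b).
Proof. by move=> X; apply: matrix_tensP => i j k l; rewrite !ptransE. Qed.

Lemma ptrans1 a b : ptrans (1%:M : 'M[C]_(a * b)) = 1%:M.
Proof.
apply: matrix_tensP => i j k l; rewrite ptransE !mxE.
rewrite !(inj_eq (can_inj (@mxtens_indexK _ _))) !xpair_eqE.
by rewrite [j == l]eq_sym.
Qed.

Lemma mxtrace_ptrans a b (X : 'M[C]_(a * b)) : \tr (ptrans X) = \tr X.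
Proof.
rewrite /mxtrace !sum_mxtens.
by apply: eq_bigr => i _; apply: eq_bigr => j _; rewrite ptransE.
Qed.

Lemma trmx_ptrans a b (X : 'M[C]_(a * b)) : (ptrans X)^T = ptrans X^T.
Proof. by apply: matrix_tensP => i j k l; rewrite !(mxE, ptransE). Qed.

Lemma ptransposeBB'E a b a' b' (J : 'M[C]_((a * b) * (a' * b')))
    i j k l i' j' k' l' :
  ptransposeBB' J
    (mxtens_index (mxtens_index (i, j), mxtens_index (i', j')))
    (mxtens_index (mxtens_index (k, l), mxtens_index (k', l'))) =
  J (mxtens_index (mxtens_index (i, l), mxtens_index (i', l')))
    (mxtens_index (mxtens_index (k, j), mxtens_index (k', j'))).
Proof. by rewrite mxE !mxtens_indexK. Qed.

Lemma bipartite_tensP a b a' b' (J K : 'M[C]_((a * b) * (a' * b'))) :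
  (forall i j k l i' j' k' l',
    J (mxtens_index (mxtens_index (i, j), mxtens_index (i', j')))
      (mxtens_index (mxtens_index (k, l), mxtens_index (k', l'))) =
    K (mxtens_index (mxtens_index (i, j), mxtens_index (i', j')))
      (mxtens_index (mxtens_index (k, l), mxtens_index (k', l')))) -> J = K.
Proof.
move=> JK; apply: matrix_tensP => x x' y y'.
case: (mxtens_indexP x) => i j; case: (mxtens_indexP y) => k l.
by case: (mxtens_indexP x') => i' j'; case: (mxtens_indexP y').
Qed.

Lemma ptransposeBB'_is_linear a b a' b' : linear (@ptransposeBB' R a b a' b').
Proof.
by move=> c J K; apply: bipartite_tensP => *; rewrite !(ptransposeBB'E, mxE).
Qed.

HB.instance Definition _ a b a' b' :=
  GRing.isLinear.Build C _ _ _ (@ptransposeBB' R a b a' b')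
    (@ptransposeBB'_is_linear a b a' b').

Lemma ptransposeBB'_tens a b a' b' (X : 'M[C]_(a * b)) (Y : 'M[C]_(a' * b')) :
  ptransposeBB' (X *t Y) = ptrans X *t ptrans Y.
Proof.
by apply: bipartite_tensP => *; rewrite ptransposeBB'E !tensmxE !ptransE.
Qed.

(** Written as eightfold sums, the two sides differ by the renaming that exchanges j with l and j'
    with l'; the rest is reordering of sums. *)
Lemma mxtrace_ptransposeBB' a b a' b' (J K : 'M[C]_((a * b) * (a' * b'))) :
  \tr (ptransposeBB' J *m K) = \tr (J *m ptransposeBB' K).
Proof.
have trE (A B : 'M[C]_((a * b) * (a' * b'))) : \tr (A *m B) =
    \sum_i \sum_j \sum_i' \sum_j' \sum_k \sum_l \sum_k' \sum_l'
    A (mxtens_index (mxtens_index (i, j), mxtens_index (i', j')))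
      (mxtens_index (mxtens_index (k, l), mxtens_index (k', l'))) *
    B (mxtens_index (mxtens_index (k, l), mxtens_index (k', l')))
      (mxtens_index (mxtens_index (i, j), mxtens_index (i', j'))).
  rewrite /mxtrace 2!sum_mxtens; do 2![apply: eq_bigr => ? _].
  rewrite sum_mxtens; do 2![apply: eq_bigr => ? _].
  rewrite mxE 2!sum_mxtens; do 2![apply: eq_bigr => ? _].
  by rewrite sum_mxtens.
rewrite !trE; apply: eq_bigr => i _.
transitivity (\sum_j \sum_j' \sum_l \sum_l' \sum_i' \sum_k \sum_k'
    J (mxtens_index (mxtens_index (i, l), mxtens_index (i', l')))
      (mxtens_index (mxtens_index (k, j), mxtens_index (k', j'))) *
    K (mxtens_index (mxtens_index (k, l), mxtens_index (k', l')))
      (mxtens_index (mxtens_index (i, j), mxtens_index (i', j')))).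
  apply: eq_bigr => j _; rewrite exchange_big; apply: eq_bigr => j' _ /=.
  under eq_bigr => i' _ do under eq_bigr => k _ do under eq_bigr => l _ do
    rewrite exchange_big.
  under eq_bigr => i' _ do rewrite exchange_big.
  rewrite exchange_big; apply: eq_bigr => l _ /=.
  under eq_bigr => i' _ do rewrite exchange_big.
  rewrite exchange_big; apply: eq_bigr => l' _ /=.
  apply: eq_bigr => i' _; apply: eq_bigr => k _; apply: eq_bigr => k' _.
  by rewrite ptransposeBB'E.
transitivity (\sum_l \sum_l' \sum_j \sum_j' \sum_i' \sum_k \sum_k'
    J (mxtens_index (mxtens_index (i, l), mxtens_index (i', l')))
      (mxtens_index (mxtens_index (k, j), mxtens_index (k', j'))) *
    K (mxtens_index (mxtens_index (k, l), mxtens_index (k', l')))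
      (mxtens_index (mxtens_index (i, j), mxtens_index (i', j')))).
  under eq_bigr => j _ do rewrite exchange_big.
  rewrite exchange_big; apply: eq_bigr => l _ /=.
  under eq_bigr => j _ do rewrite exchange_big.
  by rewrite exchange_big.
apply: eq_bigr => l _; rewrite [RHS]exchange_big; apply: eq_bigr => l' _ /=.
under [RHS]eq_bigr => i' _ do under eq_bigr => k _ do under eq_bigr => j _ do
  rewrite exchange_big.
under [RHS]eq_bigr => i' _ do rewrite exchange_big.
rewrite [RHS]exchange_big; apply: eq_bigr => j _ /=.
under [RHS]eq_bigr => i' _ do rewrite exchange_big.
rewrite [RHS]exchange_big; apply: eq_bigr => j' _ /=.
apply: eq_bigr => i' _; apply: eq_bigr => k _; apply: eq_bigr => k' _.
by rewrite ptransposeBB'E.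
Qed.

Lemma choiE a b m' (Phi : 'M[C]_(a * b) -> 'M[C]_m') x x' y y' :
  choi Phi (mxtens_index (x, x')) (mxtens_index (y, y')) =
  Phi (delta_mx x y) x' y'.
Proof.
case: (mxtens_indexP x) => i j; case: (mxtens_indexP y) => k l.
pose f x y := (delta_mx x y *t Phi (delta_mx x y))
  (mxtens_index (mxtens_index (i, j), x')) (mxtens_index (mxtens_index (k, l), y')).
have -> : choi Phi (mxtens_index (mxtens_index (i, j), x'))
    (mxtens_index (mxtens_index (k, l), y')) = \sum_x \sum_y f x y.
  rewrite sum_mxtens /choi !summxE; apply: eq_bigr => i0 _.
  rewrite summxE; apply: eq_bigr => j0 _; rewrite sum_mxtens summxE.
  by apply: eq_bigr => k0 _; rewrite summxE.
rewrite (bigD1 (mxtens_index (i, j))) //= [X in _ + X]big1 ?addr0; last first.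
  move=> x0 xx0; rewrite big1 // => y0 _.
  by rewrite /f tensmxE mxE eq_sym (negPf xx0) mul0r.
rewrite (bigD1 (mxtens_index (k, l))) //= [X in _ + X]big1 ?addr0; last first.
  by move=> y0 yy0; rewrite /f tensmxE mxE [_ == y0]eq_sym (negPf yy0) andbF mul0r.
by rewrite /f tensmxE mxE !eqxx mul1r.
Qed.

(** The block of the Choi matrix at (x, y) is Pi (E_xy), and tr (E_xy X) = X_yx; this is where the
    transpose on the input comes from. *)
Lemma mxtrace_choi a b m' (Pi : {linear 'M[C]_(a * b) -> 'M[C]_m'})
    (X : 'M[C]_(a * b)) (Y : 'M[C]_m') :
  \tr (choi Pi *m (X *t Y)) = \tr (Pi X^T *m Y).
Proof.
transitivity (\sum_x \sum_y X y x * \tr (Pi (delta_mx x y) *m Y)); last first.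
  rewrite [X^T in RHS]matrix_sum_delta linear_sum mulmx_suml [RHS]raddf_sum.
  apply: eq_bigr => x _; rewrite linear_sum mulmx_suml [RHS]raddf_sum.
  by apply: eq_bigr => y _; rewrite linearZ -scalemxAl /= mxtraceZ mxE.
rewrite [LHS]sum_mxtens; apply: eq_bigr => x _.
under eq_bigr => x' _ do rewrite mxE sum_mxtens.
rewrite exchange_big; apply: eq_bigr => y _; rewrite mulr_sumr.
apply: eq_bigr => x' _; rewrite mxE mulr_sumr; apply: eq_bigr => y' _.
by rewrite choiE tensmxE mulrCA.
Qed.

(** For k > 0 this is the swap |ij> -> |ji>. Defining it from Psi_k makes its partial transpose
    immediate. *)
Definition swapmx k : 'M[C]_(k * k) := k%:R *: ptrans (max_entangled k).

Lemma max_entangledE k (i j i' j' : 'I_k) :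
  max_entangled k (mxtens_index (i, j)) (mxtens_index (i', j')) =
  (k%:R^-1 * ((i == j) && (i' == j'))%:R) :> C.
Proof.
rewrite mxE summxE (bigD1 i) //= [X in _ * (_ + X)]big1 ?addr0; last first.
  move=> x xi; rewrite summxE big1 // => y _; rewrite mxE.
  by rewrite !(inj_eq (can_inj (@mxtens_indexK _ _))) !xpair_eqE eq_sym (negPf xi).
rewrite summxE (bigD1 i') //= [X in _ * (_ + X)]big1 ?addr0; last first.
  move=> x xi; rewrite mxE.
  by rewrite !(inj_eq (can_inj (@mxtens_indexK _ _))) !xpair_eqE
    [i' == x]eq_sym (negPf xi) andbF.
rewrite mxE !(inj_eq (can_inj (@mxtens_indexK _ _))) !xpair_eqE !eqxx /=.
by rewrite eq_sym [j' == _]eq_sym.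
Qed.

Variable k : nat.
Hypothesis k_gt0 : (0 < k)%N.
Let k_neq0 : k%:R != 0 :> C. Proof. by rewrite pnatr_eq0 -lt0n. Qed.

Lemma swapmxE (i j i' j' : 'I_k) :
  swapmx k (mxtens_index (i, j)) (mxtens_index (i', j')) =
  ((i == j') && (i' == j))%:R.
Proof. by rewrite mxE ptransE max_entangledE mulVKf. Qed.

Lemma ptrans_max_entangled : ptrans (max_entangled k) = k%:R^-1 *: swapmx k.
Proof. by rewrite scalerA mulVf // scale1r. Qed.

Lemma ptrans_swapmx : ptrans (swapmx k) = k%:R *: max_entangled k.
Proof. by rewrite linearZ /= ptransK. Qed.

Lemma trmx_max_entangled : (max_entangled k)^T = max_entangled k :> 'M[C]_(k * k).
Proof. by apply: matrix_tensP => *; rewrite mxE !max_entangledE andbC. Qed.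

Lemma trmx_swapmx : (swapmx k)^T = swapmx k.
Proof. by rewrite /swapmx linearZ /= trmx_ptrans trmx_max_entangled. Qed.

Lemma mxtrace_max_entangled : \tr (max_entangled k) = 1 :> C.
Proof.
rewrite /mxtrace sum_mxtens.
under eq_bigr => i _.
  rewrite (bigD1 i) //= big1 ?addr0; last first.
    by move=> j ji; rewrite max_entangledE eq_sym (negPf ji) mulr0.
  rewrite max_entangledE !eqxx mulr1; over.
by rewrite sumr_const card_ord -(mulr_natr (_ ^-1)) mulVf.
Qed.

Lemma orthoproj_max_entangled : orthoproj (max_entangled k : 'M[C]_(k * k)).
Proof.
split.
  rewrite trmx_max_entangled; apply: matrix_tensP => *; rewrite mxE !max_entangledE.
  by rewrite rmorphM fmorphV /= !conjC_nat.
apply: matrix_tensP => i j i' j'; rewrite mxE sum_mxtens.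
under eq_bigr => x _.
  rewrite (bigD1 x) //= big1 ?addr0; last first.
    by move=> y yx; rewrite max_entangledE [x == y]eq_sym (negPf yx) andbF mulr0 mul0r.
  rewrite !max_entangledE !eqxx andbT; over.
rewrite sumr_const card_ord max_entangledE -(mulr_natr (_ * _)); case: (i == j) => /=.
  by field.
by rewrite mulr0 !mul0r.
Qed.

Lemma mxtrace_swapmx : \tr (swapmx k) = k%:R.
Proof. by rewrite linearZ /= mxtrace_ptrans mxtrace_max_entangled mulr1. Qed.

Lemma swapmxK : swapmx k *m swapmx k = 1%:M.
Proof.
apply: matrix_tensP => i j i' j'; rewrite mxE sum_mxtens (bigD1 j) //=.
rewrite [X in _ + X]big1 ?addr0; last first.
  by move=> x xj; rewrite big1 // => y _; rewrite swapmxE (negPf xj) andbF mul0r.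
rewrite (bigD1 i) //= [X in _ + X]big1 ?addr0; last first.
  by move=> y yi; rewrite swapmxE eq_sym (negPf yi) mul0r.
rewrite !swapmxE !eqxx mul1r mxE (inj_eq (can_inj (@mxtens_indexK _ _))) xpair_eqE.
by rewrite andbC [i' == i]eq_sym.
Qed.

Definition isotropic_proj (a : bool) : 'M[C]_(k * k) :=
  if a then max_entangled k else 1%:M - max_entangled k.

Definition symmetric_proj (b : bool) : 'M[C]_(k * k) :=
  2^-1 *: (1%:M + (-1) ^+ (~~ b) *: swapmx k).

Lemma orthoproj_isotropic a : orthoproj (isotropic_proj a).
Proof.
by case: a; [|apply: orthoprojB]; exact: orthoproj_max_entangled.
Qed.

Lemma orthoproj_symmetric b : orthoproj (symmetric_proj b).
Proof.
have swap_adj : (swapmx k)^t* = swapmx k.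
  rewrite trmx_swapmx; apply: matrix_tensP => *; rewrite mxE !swapmxE.
  by rewrite conjC_nat.
split.
  rewrite adjmxZ adjmxD adjmx1 adjmxZ swap_adj fmorphV /= conjC_nat.
  by rewrite rmorph_sign.
rewrite /symmetric_proj -scalemxAl -scalemxAr scalerA mulmxDl mulmxDr !mul1mx mulmxDr mulmx1.
rewrite -scalemxAl -scalemxAr scalerA -signr_addb addbb expr0 scale1r swapmxK.
rewrite [X in _ + X]addrC -mulr2n; move: (1%:M + _) => A.
rewrite -(scaler_nat 2 A) scalerA.
by rewrite -mulrA mulVf ?mulr1 // pnatr_eq0.
Qed.

Lemma trmx_symmetric_proj b : (symmetric_proj b)^T = symmetric_proj b.
Proof. by rewrite linearZ linearD linearZ /= trmx1 trmx_swapmx. Qed.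

Lemma trmx_isotropic_proj a : (isotropic_proj a)^T = isotropic_proj a.
Proof. by case: a => /=; rewrite ?linearB /= ?trmx1 trmx_max_entangled. Qed.

Lemma ptrans_symmetric_proj b : ptrans (symmetric_proj b) =
  2^-1 *: (1%:M + ((-1) ^+ (~~ b) * k%:R) *: max_entangled k).
Proof.
by rewrite linearZ linearD linearZ /= ptrans1 ptrans_swapmx scalerA.
Qed.

(** The partial transpose of Psi_k is the swap divided by k, and the swap acts as 1 on Sym and as -1
    on Antisym. *)
Lemma ptrans_isotropic_sum a : ptrans (isotropic_proj a) =
  \sum_b (transpose_coef k a b)%:C *: symmetric_proj b.
Proof.
have -> : ptrans (isotropic_proj a) =
    (if a then 0 else 1%:M) + (-1) ^+ (~~ a) *: (k%:R^-1 *: swapmx k).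
  case: a; rewrite /isotropic_proj /= ?linearB /= ptrans_max_entangled ?ptrans1.
    by rewrite expr0 scale1r add0r.
  by rewrite expr1 scaleN1r.
have Cn : (k%:R : R)%:C = k%:R by rewrite rmorph_nat.
rewrite big_bool /symmetric_proj /transpose_coef; move: (swapmx k) => V.
rewrite !scalerDr !scalerA [RHS]addrACA -!scalerDl.
case: a; rewrite /= ?expr0 ?expr1; congr (_ + _).
- by rewrite -(scale0r 1%:M); congr (_ *: _);
    rewrite !rmorphM rmorphN fmorphV rmorph1 /= Cn; field.
- by congr (_ *: _); rewrite !rmorphM rmorphN fmorphV rmorph1 /= Cn; field.
- by rewrite -{1}[1%:M]scale1r; congr (_ *: _);
    rewrite !rmorphM rmorphB rmorphD fmorphV rmorph1 /= Cn; field.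
- by congr (_ *: _); rewrite !rmorphM rmorphB rmorphD fmorphV rmorph1 /= Cn; field.
Qed.

Lemma ptrans_symmetric_sum b : ptrans (symmetric_proj b) =
  \sum_a (transpose_coef_inv k b a)%:C *: isotropic_proj a.
Proof.
have Cn : (k%:R : R)%:C = k%:R by rewrite rmorph_nat.
have half : (2^-1 : R)%:C = 2^-1 by rewrite fmorphV rmorph_nat.
rewrite ptrans_symmetric_proj big_bool /isotropic_proj; move: (max_entangled k) => P.
have -> : (transpose_coef_inv k b true)%:C = 2^-1 + 2^-1 * ((-1) ^+ (~~ b) * k%:R) :> C.
  by rewrite !rmorphM rmorphD rmorphM /= rmorph_sign rmorph1 Cn half mulrDr mulr1.
have -> : (transpose_coef_inv k b false)%:C = 2^-1 :> C.
  by rewrite /transpose_coef_inv mulr1 half.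
by rewrite scalerDr scalerA [RHS]addrC scalerBr scalerDl addrA subrK.
Qed.

Definition isotropic_dim (a : bool) : R := if a then 1 else k%:R ^+ 2 - 1.

Definition symmetric_dim (b : bool) : R :=
  2^-1 * (k%:R * (k%:R + (-1) ^+ (~~ b))).

Lemma mxtrace_isotropic_proj a : \tr (isotropic_proj a) = (isotropic_dim a)%:C.
Proof.
case: a; rewrite /isotropic_proj /isotropic_dim ?linearB /= mxtrace_max_entangled //.
by rewrite mxtrace1 rmorphB rmorphXn /= !rmorph_nat natrM expr2.
Qed.

Lemma mxtrace_symmetric_proj b : \tr (symmetric_proj b) = (symmetric_dim b)%:C.
Proof.
rewrite /symmetric_dim linearZ linearD linearZ /= mxtrace1 mxtrace_swapmx.
rewrite natrM !rmorphM rmorphD /= rmorph_sign fmorphV /= !rmorph_nat.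
by congr (_ * _); rewrite mulrDr [X in _ + X]mulrC.
Qed.

(** Both sides are the trace of [isotropic_proj a] times the partial transpose of
    [symmetric_proj b], on the right with the transpose moved to the other factor. The identity
    converts the inverse coefficients into those of the linear program. *)
Lemma transpose_coef_duality a b :
  transpose_coef_inv k b a * isotropic_dim a =
  transpose_coef k a b * symmetric_dim b.
Proof.
have k0 : k%:R != 0 :> R by rewrite pnatr_eq0 -lt0n.
by case: a; case: b; rewrite /transpose_coef_inv /transpose_coef /isotropic_dim
  /symmetric_dim /= ?expr0 ?expr1; field.
Qed.

Lemma isotropicE (F : R) : isotropic k F =
  \sum_a ((if a then F else 1 - F) / isotropic_dim a)%:C *: isotropic_proj a.
Proof. by rewrite big_bool /isotropic_proj /isotropic_dim divr1. Qed.

End PartialTranspose.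
(** * Tensor powers *)

Section TensorPower.
Context {R : realType} {n a b : nat}.
Local Notation C := R[i].
Local Notation N := (#|{ffun 'I_n -> 'I_a}| * #|{ffun 'I_n -> 'I_b}|)%N.

(** Undoes the regrouping A^n : B^n: the j-th letters of the two strings coded by x form an index of
    the j-th copy of AB. *)
Definition site (x : 'I_N) (j : 'I_n) : 'I_(a * b) :=
  mxtens_index (enum_val (mxtens_unindex x).1 j, enum_val (mxtens_unindex x).2 j).

Definition tprod (f : 'I_n -> 'M[C]_(a * b)) : 'M[C]_N :=
  \matrix_(x, y) \prod_j f j (site x j) (site y j).

Lemma site_inj x y : site x =1 site y -> x = y.
Proof.
case: (mxtens_indexP x) => i k; case: (mxtens_indexP y) => i' k' xy.
suff [-> ->] : i = i' /\ k = k' by [].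
by split; apply: enum_val_inj; apply/ffunP => j;
  have := congr1 (@mxtens_unindex _ _) (xy j); rewrite /site !mxtens_indexK => -[].
Qed.

(** The map x -> [site x] is a bijection onto the n-tuples of indices of AB, so the product of sums
    expands over x. *)
Lemma sum_site (g : 'I_n -> 'I_(a * b) -> C) :
  \sum_x \prod_j g j (site x j) = \prod_j \sum_y g j y.
Proof.
rewrite bigA_distr_bigA /=.
pose inv (h : {ffun 'I_n -> 'I_(a * b)}) : 'I_N :=
  mxtens_index (enum_rank [ffun j => (mxtens_unindex (h j)).1],
                enum_rank [ffun j => (mxtens_unindex (h j)).2]).
have siteK (h : {ffun 'I_n -> 'I_(a * b)}) j : site (inv h) j = h j.
  rewrite /site /inv mxtens_indexK -[RHS]mxtens_unindexK.
  rewrite [RHS](congr1 _ (surjective_pairing _)); congr (mxtens_index (_, _)).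
    by rewrite (enum_rankK [ffun j => (mxtens_unindex (h j)).1]) ffunE.
  by rewrite (enum_rankK [ffun j => (mxtens_unindex (h j)).2]) ffunE.
rewrite (reindex (fun x => [ffun j => site x j])) /=.
  by apply: eq_bigr => x _; apply: eq_bigr => j _; rewrite ffunE.
exists inv => [x _|h _]; first by apply: site_inj => j; rewrite siteK ffunE.
by apply/ffunP => j; rewrite ffunE siteK.
Qed.

Lemma eq_tprod f g : f =1 g -> tprod f = tprod g.
Proof.
by move=> fg; apply/matrixP => x y; rewrite !mxE; apply: eq_bigr => j _; rewrite fg.
Qed.

Lemma tprod_mul f g : tprod f *m tprod g = tprod (fun j => f j *m g j).
Proof.
apply/matrixP => x y; rewrite !mxE.
under [LHS]eq_bigr => z _ do rewrite !mxE -big_split /=.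
rewrite (sum_site (fun j z => f j (site x j) z * g j z (site y j))).
by apply: eq_bigr => j _; rewrite mxE.
Qed.

Lemma mxtrace_tprod f : \tr (tprod f) = \prod_j \tr (f j).
Proof.
rewrite /mxtrace -(sum_site (fun j z => f j z z)).
by apply: eq_bigr => x _; rewrite mxE.
Qed.

Lemma trmx_tprod f : (tprod f)^T = tprod (fun j => (f j)^T).
Proof. by apply/matrixP => x y; rewrite !mxE; apply: eq_bigr => j _; rewrite mxE. Qed.

Lemma adjmx_tprod f : (tprod f)^t* = tprod (fun j => (f j)^t*).
Proof.
by apply/matrixP => x y; rewrite !mxE rmorph_prod; apply: eq_bigr => j _; rewrite !mxE.
Qed.

Lemma orthoproj_tprod f : (forall j, orthoproj (f j)) -> orthoproj (tprod f).
Proof.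
move=> pf; split; rewrite ?adjmx_tprod ?tprod_mul; apply: eq_tprod => j.
  by case: (pf j).
by case: (pf j).
Qed.

Lemma tprod1 : tprod (fun=> 1%:M) = 1%:M.
Proof.
apply/matrixP => x y; rewrite !mxE; have [->|xy] := eqVneq x y.
  by rewrite big1 // => j _; rewrite mxE eqxx.
have [j xyj] : exists j, site x j != site y j.
  apply/existsP; apply: contraNT xy; rewrite negb_exists => /forallP xy.
  by apply/eqP/site_inj => j; have := xy j; rewrite negbK => /eqP.
by rewrite (bigD1 j) //= mxE (negPf xyj) mul0r.
Qed.

Lemma ptrans_tprod f : ptrans (tprod f) = tprod (fun j => ptrans (f j)).
Proof.
apply: matrix_tensP => i k i' k'; rewrite ptransE !mxE.
by apply: eq_bigr => j _; rewrite /site !mxtens_indexK ptransE.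
Qed.

Lemma tprod_sum (I : finType) (c : 'I_n -> I -> R) (f : I -> 'M[C]_(a * b)) :
  tprod (fun j => \sum_i (c j i)%:C *: f i) =
  \sum_(h : {ffun 'I_n -> I}) (\prod_j c j (h j))%:C *: tprod (fun j => f (h j)).
Proof.
apply/matrixP => x y; rewrite mxE summxE.
under eq_bigr => j _.
  rewrite summxE; under eq_bigr => i _ do rewrite mxE; over.
rewrite bigA_distr_bigA; apply: eq_bigr => h _.
by rewrite big_split /= !mxE rmorph_prod.
Qed.

Lemma tensor_powerE (rho : 'M[C]_(a * b)) : tensor_power n rho = tprod (fun=> rho).
Proof. by apply/matrixP => x y; rewrite !mxE. Qed.

End TensorPower.

(** * Measure-and-prepare maps *)

Section MeasurePrepare.
Context {R : realType}.
Local Notation C := R[i].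

Definition measure_prepare m m' (I : finType) (P : I -> 'M[C]_m)
    (N : I -> 'M[C]_m') (X : 'M[C]_m) : 'M[C]_m' :=
  \sum_i \tr (P i *m X) *: N i.

Lemma measure_prepare_is_linear m m' I P N : linear (@measure_prepare m m' I P N).
Proof.
move=> c X Y; rewrite /measure_prepare scaler_sumr -big_split; apply: eq_bigr => i _ /=.
by rewrite mulmxDr -scalemxAr mxtraceD mxtraceZ scalerDl scalerA.
Qed.

HB.instance Definition _ m m' I P N :=
  GRing.isLinear.Build C _ _ _ (@measure_prepare m m' I P N)
    (@measure_prepare_is_linear m m' I P N).

Lemma mxtrace_mul_delta m (A : 'M[C]_m) x y : \tr (A *m delta_mx x y) = A y x.
Proof.
rewrite -(mul_delta_mx (0 : 'I_1) x y) mulmxA -colE mxtrace_mulC -rowE.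
by rewrite /mxtrace big_ord1 !mxE.
Qed.

(** On matrix units tr (P_i E_xy) is the entry (y, x) of P_i, so the measurement enters
    transposed. *)
Lemma choi_measure_prepare a b m' (I : finType) (P : I -> 'M[C]_(a * b))
    (N : I -> 'M[C]_m') :
  choi (measure_prepare P N) = \sum_i (P i)^T *t N i.
Proof.
apply: matrix_tensP => x x' y y'; rewrite choiE !summxE; apply: eq_bigr => i _.
by rewrite tensmxE mxE mxtrace_mul_delta [(P i)^T _ _]mxE.
Qed.

End MeasurePrepare.

(** * PPT operations and feasible points *)

Section Distillation.
Context {R : realType}.
Local Notation C := R[i].

Lemma ge0_complexE (z : C) : 0 <= z -> z = (complex.Re z)%:C.
Proof. by case: z => x y; rewrite lecE /= => /andP[/eqP -> _]. Qed.

(** An ancilla of dimension 1 extracts plain positivity from complete positivity; it has to be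
    carried along because [1 * m] and [m] are different matrix sizes. *)
Lemma completely_positive_trace_ge0 m m' (Pi : 'M[C]_m -> 'M[C]_m')
    (P : 'M[C]_m) (N : 'M[C]_m') :
  completely_positive Pi -> orthoproj P -> orthoproj N -> 0 <= \tr (Pi P *m N).
Proof.
move=> cpPi pP pN.
have amp : ampliation Pi ((1%:M : 'M[C]_1) *t P) = 1%:M *t Pi P.
  apply: matrix_tensP => p x q y; rewrite ampliationE tensmxE !ord1 [1%:M _ _]mxE mul1r.
  by congr (Pi _ _ _); apply/matrixP => i j; rewrite mxE tensmxE mxE mul1r.
have := cpPi 1 _ (psdmx_orthoproj (orthoproj_tens (orthoproj1 1) pP)).
rewrite amp => /psdmx_trace_orthoproj/(_ (orthoproj_tens (orthoproj1 1) pN)).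
by rewrite tensmx_mul mulmx1 mxtrace_tens mxtrace1 mul1r.
Qed.

(** The partial transpose moves from the Choi matrix to the projector P (x) N, on which it acts
    factorwise. *)
Lemma ppt_trace_ge0 a b a' b' (Pi : {linear 'M[C]_(a * b) -> 'M[C]_(a' * b')})
    (P : 'M[C]_(a * b)) (N : 'M[C]_(a' * b')) :
  psdmx (ptransposeBB' (choi Pi)) -> orthoproj P -> orthoproj N ->
  0 <= \tr (Pi (ptrans P)^T *m ptrans N).
Proof.
move=> pptPi pP pN.
have := psdmx_trace_orthoproj pptPi (orthoproj_tens pP pN).
by rewrite mxtrace_ptransposeBB' ptransposeBB'_tens mxtrace_choi.
Qed.

Variables (d n : nat) (d_gt1 : (1 < d)%N).
Implicit Types s t : {ffun 'I_n -> bool}.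
Let d_gt0 : (0 < d)%N. Proof. exact: ltnW. Qed.

Definition isotropic_string s := tprod (fun j => @isotropic_proj R d (s j)).
Definition symmetric_string t := tprod (fun j => @symmetric_proj R d (t j)).

Lemma orthoproj_isotropic_string s : orthoproj (isotropic_string s).
Proof. by apply: orthoproj_tprod => j; exact: orthoproj_isotropic. Qed.

Lemma orthoproj_symmetric_string t : orthoproj (symmetric_string t).
Proof. by apply: orthoproj_tprod => j; exact: orthoproj_symmetric. Qed.

Lemma ptrans_isotropic_string s : ptrans (isotropic_string s) =
  \sum_(t : {ffun 'I_n -> bool})
    (\prod_j transpose_coef d (s j) (t j))%:C *: symmetric_string t.
Proof.
rewrite ptrans_tprod.
rewrite -(tprod_sum (fun j => transpose_coef d (s j)) (@symmetric_proj R d)).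
apply: eq_tprod => j.
exact: ptrans_isotropic_sum.
Qed.

Lemma ptrans_symmetric_string t : ptrans (symmetric_string t) =
  \sum_(s : {ffun 'I_n -> bool})
    (\prod_j transpose_coef_inv d (t j) (s j))%:C *: isotropic_string s.
Proof.
rewrite ptrans_tprod.
rewrite -(tprod_sum (fun j => transpose_coef_inv d (t j)) (@isotropic_proj R d)).
apply: eq_tprod => j.
exact: ptrans_symmetric_sum.
Qed.

Lemma trmx_isotropic_string s : (isotropic_string s)^T = isotropic_string s.
Proof. by rewrite trmx_tprod; apply: eq_tprod => j; exact: trmx_isotropic_proj. Qed.

Lemma trmx_symmetric_string t : (symmetric_string t)^T = symmetric_string t.
Proof. by rewrite trmx_tprod; apply: eq_tprod => j; exact: trmx_symmetric_proj. Qed.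

Lemma mxtrace_isotropic_string s :
  \tr (isotropic_string s) = (\prod_j isotropic_dim d (s j))%:C.
Proof.
rewrite mxtrace_tprod rmorph_prod; apply: eq_bigr => j _.
exact: mxtrace_isotropic_proj.
Qed.

Lemma mxtrace_symmetric_string t :
  \tr (symmetric_string t) = (\prod_j symmetric_dim d (t j))%:C.
Proof.
rewrite mxtrace_tprod rmorph_prod; apply: eq_bigr => j _.
exact: mxtrace_symmetric_proj.
Qed.

Lemma isotropic_dim_gt0 x : 0 < isotropic_dim d x :> R.
Proof.
rewrite /isotropic_dim; case: x => //; rewrite subr_gt0 expr2.
by rewrite -natrM ltr1n (@leq_ltn_trans (1 * 1)) // ltn_mul.
Qed.

Lemma symmetric_dim_gt0 x : 0 < symmetric_dim d x :> R.
Proof.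
have d1 : 1 < d%:R :> R by rewrite ltr1n.
rewrite /symmetric_dim mulr_gt0 ?invr_gt0 // mulr_gt0 //; first lra.
by case: x => /=; rewrite ?expr0 ?expr1; lra.
Qed.

Lemma sum_isotropic_string : \sum_s isotropic_string s = 1%:M.
Proof.
transitivity (tprod (fun _ : 'I_n => \sum_x (1 : R)%:C *: @isotropic_proj R d x)).
  rewrite tprod_sum; apply: eq_bigr => s _.
  by rewrite big1 // rmorph1 scale1r.
rewrite -tprod1; apply: eq_tprod => j.
by rewrite big_bool rmorph1 !scale1r /= addrC subrK.
Qed.

Lemma tensor_power_isotropicE (F : R) : tensor_power n (isotropic d F) =
  \sum_(s : {ffun 'I_n -> bool})
    (\prod_j ((if s j then F else 1 - F) / isotropic_dim d (s j)))%:C *: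
      isotropic_string s.
Proof.
rewrite tensor_powerE -(tprod_sum (fun=> fun x => (if x then F else 1 - F) / isotropic_dim d x)
  (@isotropic_proj R d)).
apply: eq_tprod => j.
exact: isotropicE.
Qed.

(** The witness m_i is the average, over the isotropic strings P_s of weight i, of tr (Pi (P_s)
    Psi_k) / tr P_s. *)
Lemma ppt_operation_feasible (F : R) k
    (Pi : {linear _ -> 'M[C]_(k * k)}) :
  (0 < k)%N -> ppt_operation Pi ->
  exists m : 'I_n.+1 -> R,
  [/\ forall i, 0 <= m i <= 1,
      forall j : 'I_n.+1, `|\sum_(i < n.+1) iso_coef d n i j * m i| <= k%:R^-1
    & complex.Re (\tr (Pi (tensor_power n (isotropic d F)) *m max_entangled k)) =
      \sum_(i < n.+1) 'C(n, i)%:R * F ^+ i * (1 - F) ^+ (n - i) * m i].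
Proof.
move=> k_gt0 [cpPi tpPi pptPi].
pose f s := complex.Re (\tr (Pi (isotropic_string s) *m max_entangled k)).
pose D s := \prod_j isotropic_dim d (s j) : R.
have D_gt0 s : 0 < D s by apply: prodr_gt0 => j _; exact: isotropic_dim_gt0.
have trf_ge0 s : 0 <= \tr (Pi (isotropic_string s) *m max_entangled k).
  apply: completely_positive_trace_ge0 => //.
    exact: orthoproj_isotropic_string.
  exact: orthoproj_max_entangled.
have fE s : \tr (Pi (isotropic_string s) *m max_entangled k) = (f s)%:C.
  exact: ge0_complexE.
have f_ge0 s : 0 <= f s by rewrite -ler0c -fE.
(* By trace preservation this says that the complement 1 - Psi_k also has a nonnegative trace
   against Pi (P_s). *)
have f_leD s : f s <= D s.
  have := completely_positive_trace_ge0 cpPi (orthoproj_isotropic_string s)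
    (orthoproj_isotropic k_gt0 false).
  rewrite mulmxBr mulmx1 linearB /= tpPi fE mxtrace_isotropic_string.
  by rewrite -rmorphB /= ler0c subr_ge0.
pose m' s := f s / D s.
have fE' s : f s = D s * m' s by rewrite mulrC divfK // gt_eqF.
exists (weight_average m'); split.
- move=> i; apply: weight_average_bounds => s.
  apply/andP; split; first by rewrite divr_ge0 ?f_ge0 ?ltW.
  by rewrite /m' ler_pdivrMr ?mul1r.
- move=> j; rewrite iso_coef_weight_average // ler_norml.
  apply: weight_average_bounds => t.
  pose E : R := \prod_j symmetric_dim d (t j).
  have E_gt0 : 0 < E by apply: prodr_gt0 => ? _; exact: symmetric_dim_gt0.
  pose z := \sum_(s : {ffun 'I_n -> bool}) (\prod_j transpose_coef d (s j) (t j)) * m' s.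
  (* The partial transpose of the symmetric string Q_t, of trace E, is expanded in isotropic
     strings; [transpose_coef_duality] then brings in the coefficients of the linear program. *)
  have trz : \tr (Pi (ptrans (symmetric_string t)) *m max_entangled k) = (E * z)%:C.
    rewrite ptrans_symmetric_string linear_sum mulmx_suml [LHS]raddf_sum mulr_sumr.
    rewrite rmorph_sum; apply: eq_bigr => s _ /=.
    rewrite [Pi _]linearZ /= -scalemxAl mxtraceZ fE -rmorphM; congr (_%:C).
    rewrite fE' [LHS]mulrA; have -> : (\prod_j transpose_coef_inv d (t j) (s j)) * D s =
        (\prod_j transpose_coef d (s j) (t j)) * E.
      rewrite -!big_split; apply: eq_bigr => ? _ /=.
      exact: transpose_coef_duality.
    by rewrite -mulrA mulrCA.
  (* The tests are Q_t (x) Sym_k and Q_t (x) Antisym_k, whose second factors have partial transposes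
     (1 + k Psi_k) / 2 and (1 - k Psi_k) / 2. Dividing by E > 0 gives |z| <= 1 / k. *)
  have sgn x : 0 <= E + (-1) ^+ (~~ x) * k%:R * (E * z).
    have := ppt_trace_ge0 pptPi (orthoproj_symmetric_string t)
      (orthoproj_symmetric k_gt0 x).
    rewrite trmx_ptrans trmx_symmetric_string ptrans_symmetric_proj.
    rewrite -scalemxAr mxtraceZ pmulr_rge0 ?invr_gt0 ?ltr0n //.
    rewrite mulmxDr mulmx1 -scalemxAr mxtraceD mxtraceZ trz tpPi mxtrace_ptrans.
    have -> : (-1) ^+ (~~ x) * k%:R = ((-1) ^+ (~~ x) * k%:R)%:C :> C.
      by rewrite rmorphM /= rmorph_sign rmorph_nat.
    by rewrite mxtrace_symmetric_string -rmorphM -rmorphD ler0c.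
  have k0 : 0 < k%:R :> R by rewrite ltr0n.
  have sgn' x : 0 <= 1 + (-1) ^+ (~~ x) * k%:R * z.
    by rewrite -(pmulr_rge0 _ E_gt0) mulrDr mulr1 mulrCA.
  have := sgn' true; have := sgn' false; rewrite /= expr0 expr1 => z1 z2.
  apply/andP; split.
    by rewrite -mulN1r ler_pdivrMr // -/z; lra.
  by rewrite -[k%:R^-1]mul1r ler_pdivlMr // -/z; lra.
(* The coefficient of P_s in the state carries 1 / tr P_s, which cancels the factor [D s] of
   [f s]. *)
- rewrite tensor_power_isotropicE [Pi _]linear_sum mulmx_suml [\tr _]raddf_sum raddf_sum.
  transitivity (\sum_(s : {ffun 'I_n -> bool})
    F ^+ weight s * (1 - F) ^+ (n - weight s) * m' s).
    apply: eq_bigr => s _; rewrite [Pi _]linearZ /= -scalemxAl mxtraceZ fE -rmorphM /= fE'.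
    rewrite mulrA -big_split /= -(prod_weight (fun x => if x then F else 1 - F)).
    congr (_ * _); apply: eq_bigr => j _.
    by rewrite divfK // gt_eqF // isotropic_dim_gt0.
  rewrite sum_weight; apply: eq_bigr => i _.
  transitivity (F ^+ i * (1 - F) ^+ (n - i) * \sum_(s | weight s == i) m' s).
    by rewrite mulr_sumr; apply: eq_bigr => s /eqP <-.
  by rewrite -weight_averageE mulrCA !mulrA.
Qed.

(** * Isotropic outputs and the achieving operation *)

Lemma mxtrace_isotropic k (z : R) : (1 < k)%N || (z == 1) -> (0 < k)%N ->
  \tr (isotropic k z) = 1 :> C.
Proof.
move=> kz k_gt0; rewrite isotropicE raddf_sum.
under eq_bigr => x _ do rewrite /= mxtraceZ mxtrace_isotropic_proj // -rmorphM /=.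
rewrite big_bool /= -rmorphD /isotropic_dim /= divr1 mulr1.
have [k1|] := ltnP 1 k.
  rewrite divfK ?subrKC // gt_eqF // subr_gt0 expr2 -natrM ltr1n.
  by rewrite (@leq_ltn_trans (1 * 1)) // ltn_mul.
case/orP: kz => [kk kk'|/eqP -> _]; first by rewrite ltnNge kk' in kk.
by rewrite subrr !mul0r addr0.
Qed.

Lemma mxtrace_isotropic_mul_proj k (z : R) : (0 < k)%N ->
  \tr (isotropic k z *m max_entangled k) = z%:C :> C.
Proof.
move=> k_gt0; have [_ iP] := @orthoproj_max_entangled R k k_gt0.
rewrite isotropicE big_bool /=; move: iP (mxtrace_max_entangled (R := R) k_gt0).
move: (max_entangled k) => P iP trP; rewrite mulmxDl -!scalemxAl iP mulmxBl mul1mx iP.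
by rewrite subrr scaler0 addr0 mxtraceZ trP mulr1 divr1.
Qed.

(* At k = 1 the weight (1 - z) / (k^2 - 1) is the junk value 0, so isotropic 1 z
   is z *: Psi_1, a state only for z = 1. *)
Lemma ptrans_isotropic_pos k (z : R) : (0 < k)%N ->
  (1 < k)%N || (z == 1) -> `|z| <= k%:R^-1 ->
  exists (g : bool -> R) (N : bool -> 'M[C]_(k * k)),
    [/\ forall b, 0 <= g b, forall b, orthoproj (N b)
      & ptrans (isotropic k z) = \sum_b (g b)%:C *: N b].
Proof.
move=> k_gt0 kz zk; have [k1|k1] := ltnP 1 k; last first.
  have {k1 k_gt0} k1 : k = 1%N by apply/eqP; rewrite eqn_leq k1.
  rewrite {}k1 in kz *; rewrite /= in kz; have /eqP -> := kz.
  (* At k = 1 the antisymmetric projector is 0 and the general formula would give it the coefficient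
     -1, so the weights 1 and 0 on Psi_1 are used instead. *)
  exists (fun b => b%:R), (fun=> max_entangled 1); split => [b|b|].
  - by rewrite ler0n.
  - exact: orthoproj_max_entangled.
  - apply: matrix_tensP => i j i' j'; rewrite ptransE !ord1.
    by rewrite isotropicE !big_bool /= subrr mul0r !scale0r !addr0 divr1.
pose c := (1 - z) / isotropic_dim k false.
exists (fun b => transpose_coef k true b * z + transpose_coef k false b * c),
  (symmetric_proj (R := R) k).
have kk1 : 1 < k%:R :> R by rewrite ltr1n.
have k0 : 0 < k%:R :> R by rewrite ltr0n.
have [z1 z2] : - 1 <= k%:R * z /\ k%:R * z <= 1.
  move: zk; rewrite ler_norml => /andP[z1 z2].
  by split; [rewrite mulrC -ler_pdivrMr // mulN1r|rewrite mulrC -ler_pdivlMr // mul1r].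
split => [b|b|]; last 1 first.
- rewrite isotropicE linear_sum.
  under eq_bigr => a _ do
    rewrite /= [ptrans _]linearZ /= ptrans_isotropic_sum // scaler_sumr.
  rewrite exchange_big; apply: eq_bigr => b _ /=.
  move: (symmetric_proj k b) => S.
  rewrite big_bool /= !scalerA -!rmorphM -scalerDl -rmorphD /= divr1 -/c.
  by rewrite [z * _]mulrC [c * _]mulrC.
- have kp : 0 < k%:R + 1 :> R by lra.
  have km : 0 < k%:R - 1 :> R by lra.
  (* In closed form the denominators k (k + 1) and k (k - 1) are positive for k > 1, and both
     numerators are nonnegative exactly when |z| <= 1 / k. *)
  suff -> : transpose_coef k true b * z + transpose_coef k false b * c =
      if b then (k%:R * z + 1) / (k%:R * (k%:R + 1))
      else (1 - k%:R * z) / (k%:R * (k%:R - 1)).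
    by case: b; apply: divr_ge0; rewrite ?mulr_ge0 ?(ltW k0) ?(ltW kp) ?(ltW km) //; lra.
  rewrite /c /transpose_coef /isotropic_dim; case: b; rewrite ?expr0 ?expr1;
    field; rewrite ?subr_sqr_1 ?mulf_neq0 ?(lt0r_neq0 k0) ?(lt0r_neq0 kp) ?(lt0r_neq0 km) //.
- exact: orthoproj_symmetric.
Qed.

Lemma tensmx_suml m p q r (I : finType) (c : I -> R) (A : I -> 'M[C]_(m, p))
    (B : 'M[C]_(q, r)) :
  (\sum_i (c i)%:C *: A i) *t B = \sum_i (c i)%:C *: (A i *t B).
Proof.
apply: matrix_tensP => *; rewrite tensmxE !summxE mulr_suml.
by apply: eq_bigr => i _; rewrite mxE [RHS]mxE tensmxE mulrA.
Qed.

Lemma tensmx_sumr m p q r (I : finType) (c : I -> R) (A : 'M[C]_(m, p))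
    (B : I -> 'M[C]_(q, r)) :
  A *t (\sum_i (c i)%:C *: B i) = \sum_i (c i)%:C *: (A *t B i).
Proof.
apply: matrix_tensP => *; rewrite tensmxE !summxE mulr_sumr.
by apply: eq_bigr => i _; rewrite mxE [RHS]mxE tensmxE mulrCA.
Qed.

(** The parameter enters [isotropic] affinely, hence the total weight 1. The weights may be
    negative, as some transpose coefficients are. *)
Lemma isotropic_affine k (I : finType) (w m : I -> R) : \sum_i w i = 1 ->
  isotropic k (\sum_i w i * m i) = \sum_i (w i)%:C *: isotropic k (m i) :> 'M[C]_(k * k).
Proof.
move=> w1; rewrite /isotropic; move: (max_entangled k) (1%:M - _) => P Q.
under [RHS]eq_bigr => i _ do rewrite scalerDr !scalerA.
rewrite big_split -!scaler_suml; congr (_ *: _ + _ *: _).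
  by rewrite rmorph_sum; apply: eq_bigr => i _; rewrite rmorphM.
rewrite -[X in ((X - _) / _)%:C]w1 -sumrB mulr_suml rmorph_sum; apply: eq_bigr => i _.
by rewrite -rmorphM /= -{1}[w i]mulr1 -mulrBr mulrA.
Qed.

(** With M the sum of the isotropic strings weighted by m, this is tr (M X) Psi_k + tr ((1 - M) X)
    (1 - Psi_k) / (k^2 - 1), split over strings so that its Choi matrix is a sum of tensor
    products. *)
Definition distillation_map k (m : 'I_n.+1 -> R) :=
  measure_prepare isotropic_string
    (fun s : {ffun 'I_n -> bool} => isotropic k (m (weight s))).

(** Partial transposition turns isotropic strings into symmetric strings Q_t. By affinity the
    outputs attached to Q_t collect into one isotropic operator, whose parameter is the constrained
    form at [weight t]; the bound 1 / k makes its partial transpose positive. *)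
Lemma ppt_distillation_map k (m : 'I_n.+1 -> R) : (0 < k)%N ->
  (forall i, 0 <= m i <= 1) -> (1 < k)%N || [forall i, m i == 1] ->
  (forall j : 'I_n.+1, `|\sum_(i < n.+1) iso_coef d n i j * m i| <= k%:R^-1) ->
  ppt_operation (distillation_map k m).
Proof.
move=> k_gt0 m01 km mk.
have km' i : (1 < k)%N || (m i == 1).
  by case/orP: km => [->//|/forallP ->]; rewrite orbT.
split.
- rewrite /distillation_map /measure_prepare; apply: completely_positive_sum => s.
  have [m0 m1] := andP (m01 (weight s)).
  apply: (@completely_positive_ext _ _ _ (fun X => \sum_a
    ((if a then m (weight s) else 1 - m (weight s)) / isotropic_dim k a)%:C *:
      (\tr (isotropic_string s *m X) *: isotropic_proj k a))).
    move=> X; rewrite isotropicE scaler_sumr; apply: eq_bigr => a _.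
    by rewrite !scalerA mulrC.
  apply: completely_positive_sum => a; apply: completely_positiveZ.
    rewrite ler0c; case: a; rewrite /isotropic_dim ?divr1 //.
    rewrite divr_ge0 ?subr_ge0 // expr2 -natrM ler1n.
    by rewrite muln_gt0 k_gt0.
  apply: completely_positive_measure_prepare.
    exact: orthoproj_isotropic_string.
  exact: orthoproj_isotropic.
- move=> X; rewrite /= /measure_prepare raddf_sum /=.
  under eq_bigr => s _ do rewrite mxtraceZ mxtrace_isotropic // mulr1.
  by rewrite -raddf_sum -mulmx_suml sum_isotropic_string mul1mx.
- rewrite choi_measure_prepare linear_sum /=.
  pose z t := \sum_(i < n.+1) iso_coef d n i (weight t) * m i.
  have -> : \sum_(s : {ffun 'I_n -> bool}) ptransposeBB' ((isotropic_string s)^T *t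
        isotropic k (m (weight s))) =
      \sum_t symmetric_string t *t ptrans (isotropic k (z t)).
    under eq_bigr => s _.
      rewrite ptransposeBB'_tens trmx_isotropic_string ptrans_isotropic_string.
      rewrite tensmx_suml; over.
    rewrite exchange_big; apply: eq_bigr => t _ /=; rewrite -tensmx_sumr.
    rewrite /z -(sum_weight_iso_coef d_gt1).
    rewrite (isotropic_affine _ (m \o weight) (sum_prod_transpose_coef d_gt1 t)).
    by congr (_ *t _); rewrite linear_sum; apply: eq_bigr => s _; rewrite linearZ.
  apply: psdmx_sum => t _.
  (* At k = 1 every m_i is 1, and the coefficients sum to 1. *)
  have kz : (1 < k)%N || (z t == 1).
    case/orP: km => [->//|/forallP mE]; rewrite orbC.
    rewrite /z; under eq_bigr => i _ do rewrite (eqP (mE i)) mulr1.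
    by rewrite sum_iso_coef // eqxx.
  have [g [N [g0 pN ->]]] := ptrans_isotropic_pos k_gt0 kz (mk (weight t)).
  rewrite tensmx_sumr; apply: psdmx_sum => b _; apply: psdmxZ; first by rewrite ler0c.
  exact/psdmx_orthoproj/orthoproj_tens/pN/orthoproj_symmetric_string.
Qed.

(** For a string of weight w, its trace against the n-fold state is F^w (1 - F)^(n - w), and the
    output prepared for it has overlap m_w with Psi_k. *)
Lemma fidelity_distillation_map k (F : R) (m : 'I_n.+1 -> R) : (0 < k)%N ->
  complex.Re (\tr (distillation_map k m (tensor_power n (isotropic d F))
    *m max_entangled k)) =
  \sum_(i < n.+1) 'C(n, i)%:R * F ^+ i * (1 - F) ^+ (n - i) * m i.
Proof.
move=> k_gt0; rewrite /distillation_map /measure_prepare mulmx_suml.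
rewrite [\tr _]raddf_sum raddf_sum -sum_weight_binomial; apply: eq_bigr => s _ /=.
rewrite -scalemxAl mxtraceZ mxtrace_isotropic_mul_proj // tensor_powerE tprod_mul.
rewrite mxtrace_tprod -(prod_weight (fun x => if x then F else 1 - F)).
suff -> : \prod_j \tr (isotropic_proj d (s j) *m isotropic d F) =
    (\prod_j (if s j then F else 1 - F))%:C :> C by rewrite -rmorphM.
rewrite rmorph_prod; apply: eq_bigr => j _; rewrite mxtrace_mulC.
case: (s j) => /=; first exact: mxtrace_isotropic_mul_proj.
rewrite mulmxBr mulmx1 linearB /= mxtrace_isotropic_mul_proj // mxtrace_isotropic ?d_gt1 //.
by rewrite rmorphB rmorph1.
Qed.

End Distillation.
(** * Maxima *)

Section Maxima.

Lemma max_valP (disp : Order.disp_t) (T : porderType disp) (x0 : T) (S : set T) :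
  has_max S -> is_max S (max_val x0 S).
Proof. by move=> maxS; apply: (@xgetPex _ x0 [set x | is_max S x]). Qed.

Lemma max_valE (disp : Order.disp_t) (T : porderType disp) (x0 x : T) (S : set T) :
  is_max S x -> max_val x0 S = x.
Proof.
move=> maxx; have [Sy uby] := max_valP x0 (ex_intro _ x maxx).
by apply/le_anti; rewrite (uby _ maxx.1) (maxx.2 _ Sy).
Qed.

Lemma has_max_nat (S : set nat) (N : nat) :
  S !=set0 -> (forall k, S k -> (k <= N)%N) -> has_max S.
Proof.
move=> [k0 Sk0] SN.
have exS : exists k, `[< S k >] by exists k0; apply/asboolP.
have ubS k : `[< S k >] -> (k <= N)%N by move=> /asboolP/SN.
case: (ex_maxnP exS ubS) => k /asboolP Sk maxk; exists k; split=> // j Sj.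
exact/maxk/asboolP.
Qed.

Lemma linear_form_continuous (R : realType) N (a : 'I_N -> R) :
  continuous (fun v : 'rV[R]_N => \sum_i a i * v ord0 i).
Proof.
apply: continuous_big => [|i _ v]; first exact: add_continuous.
exact: (continuous_comp (@coord_continuous R 1 N ord0 i v) (@mulrl_continuous R _ _)).
Qed.

(** The constraints cut a compact subset out of the unit cube, nonempty by hypothesis, on which the
    objective is continuous. *)
Lemma linear_program_has_max (R : realType) N (I : Type) (w : 'I_N -> R)
    (a : I -> 'I_N -> R) (c : R) :
  (exists m : 'I_N -> R, (forall i, 0 <= m i <= 1) /\
     forall j, `|\sum_i a j i * m i| <= c) ->
  has_max [set v | exists m : 'I_N -> R, [/\ forall i, 0 <= m i <= 1,
     forall j, `|\sum_i a j i * m i| <= c & v = \sum_i w i * m i]].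
Proof.
move=> [m0 [m001 m0c]].
pose A := [set v : 'rV[R]_N | forall i, `[0, 1]%classic (v ord0 i)] `&`
  \bigcap_(j in [set: I])
    ((fun v : 'rV[R]_N => \sum_i a j i * v ord0 i) @^-1` `[- c, c]%classic).
have AP (m : 'I_N -> R) : A (\row_i m i) <->
    (forall i, 0 <= m i <= 1) /\ forall j, `|\sum_i a j i * m i| <= c.
  split=> -[mA1 mA2]; split.
  - by move=> i; have := mA1 i; rewrite /= in_itv mxE.
  - move=> j; have := mA2 j Logic.I; rewrite /= in_itv /= ler_norml.
    by under eq_bigr => i _ do rewrite mxE.
  - by move=> i; rewrite /= in_itv mxE; exact: mA1.
  - move=> j _; rewrite /= in_itv /= -ler_norml.
    by under eq_bigr => i _ do rewrite mxE; exact: mA2.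
have cA : compact A.
  apply: compact_closedI.
    exact: (@rV_compact R N (fun=> `[0, 1]%classic) (fun=> @segment_compact R 0 1)).
  apply: closed_bigI => j _; apply: preimage_closed; last exact: interval_closed.
  by move=> v _; exact: linear_form_continuous.
have A0 : A !=set0 by exists (\row_i m0 i); apply/AP.
have [v /set_mem Av vmax] := EVT_max_rV A0 cA
  (continuous_subspaceT (@linear_form_continuous R N w)).
have vE : v = \row_i v ord0 i by apply/rowP => i; rewrite mxE.
exists (\sum_i w i * v ord0 i); split.
  by exists (v ord0); move: Av; rewrite vE => /AP[? ?]; split; rewrite -?vE.
move=> _ [m [m01 mc ->]]; have /mem_set/vmax : A (\row_i m i) by apply/AP.
by under eq_bigr => i _ do rewrite mxE.
Qed.

End Maxima.

(** * The linear program and the distillable dimensions *)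

Section LinearProgram.
Context {R : realType}.
Variables (d n : nat) (F eps : R).
Hypotheses (d_gt1 : (1 < d)%N) (F01 : 0 <= F <= 1) (eps01 : 0 < eps < 1).

Let rho := tensor_power n (isotropic d F).

Definition program_value (m : 'I_n.+1 -> R) :=
  \sum_(i < n.+1) 'C(n, i)%:R * F ^+ i * (1 - F) ^+ (n - i) * m i.

Definition feasible (eta : R) (m : 'I_n.+1 -> R) :=
  (forall i, 0 <= m i <= 1) /\
  forall k : 'I_n.+1, `|\sum_(i < n.+1) iso_coef d n i k * m i| <= eta.

Lemma program_value_le (m : 'I_n.+1 -> R) c :
  (forall i, m i <= c) -> program_value m <= c.
Proof.
move=> mc; rewrite -[leRHS]mul1r -(sum_binomial1 n F) mulr_suml.
have [F0 F1] := andP F01.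
apply: ler_sum => i _; apply: ler_wpM2l => //.
by rewrite !mulr_ge0 ?exprn_ge0 // subr_ge0.
Qed.

Lemma program_value1 : program_value (fun=> 1) = 1.
Proof.
by rewrite -[RHS](sum_binomial1 n F); apply: eq_bigr => i _; rewrite mulr1.
Qed.

Lemma feasible1 : feasible 1 (fun=> 1).
Proof.
split=> [i|k]; first by rewrite ler01 lexx.
under eq_bigr => i _ do rewrite mulr1.
by rewrite sum_iso_coef // normr1.
Qed.

Lemma ppt_fidelities_feasible k f : (0 < k)%N -> ppt_fidelities rho k f ->
  exists m, feasible k%:R^-1 m /\ f = program_value m.
Proof.
move=> k_gt0 [Pi [pptPi ->]].
by have [m [? ? ?]] := ppt_operation_feasible d_gt1 F k_gt0 pptPi; exists m.
Qed.

Lemma feasible_ppt_fidelities k m : (0 < k)%N ->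
  (1 < k)%N || [forall i, m i == 1] -> feasible k%:R^-1 m ->
  ppt_fidelities rho k (program_value m).
Proof.
move=> k_gt0 km [m01 mk]; exists (distillation_map (d := d) k m).
by split; [exact: ppt_distillation_map|rewrite fidelity_distillation_map].
Qed.

(** For k > 1 the fidelities are exactly the values of the linear program at eta = 1 / k. At k = 1
    the achieving map is available only for m = 1, which already attains the upper bound 1. *)
Lemma has_max_ppt_fidelities k : (0 < k)%N -> has_max (ppt_fidelities rho k).
Proof.
move=> k_gt0; have [k1|k1] := ltnP 1 k.
  suff -> : ppt_fidelities rho k = [set v | exists m : 'I_n.+1 -> R,
      [/\ forall i, 0 <= m i <= 1,
       forall j : 'I_n.+1, `|\sum_(i < n.+1) iso_coef d n i j * m i| <= k%:R^-1 &
       v = \sum_(i < n.+1) ('C(n, i)%:R * F ^+ i * (1 - F) ^+ (n - i)) * m i]].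
    apply: (@linear_program_has_max R _ _ _ (fun j i : 'I_n.+1 => iso_coef d n i j)).
    exists (fun=> 0); split=> [i|j]; first by rewrite lexx ler01.
    by rewrite big1 ?normr0 ?invr_ge0 // => i _; rewrite mulr0.
  apply/seteqP; split=> [f /(ppt_fidelities_feasible k_gt0)[m [[]]]|f [m [m01 mk ->]]].
    by exists m.
  by apply: feasible_ppt_fidelities; rewrite ?k1.
have -> : k = 1%N by apply/eqP; rewrite eqn_leq k1.
exists 1; split.
  rewrite -program_value1; apply: feasible_ppt_fidelities => //.
    by apply/orP; right; apply/forallP => i; rewrite eqxx.
  by rewrite invr1; exact: feasible1.
move=> f /(ppt_fidelities_feasible (ltn0Sn _))[m [[m01 _] ->]].
by apply: program_value_le => i; case/andP: (m01 i).
Qed.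

Lemma ppt_distillable_dimsP k : ppt_distillable_dims eps rho k <->
  (0 < k)%N /\ exists m, feasible k%:R^-1 m /\ 1 - eps <= program_value m.
Proof.
split=> -[k_gt0]; have [Fk maxF] := max_valP 0 (has_max_ppt_fidelities k_gt0).
  move=> epsF; split=> //; have [m [fm FE]] := ppt_fidelities_feasible k_gt0 Fk.
  by exists m; split=> //; rewrite -FE.
move=> [m [fm epsm]]; split=> //.
have [k1|k1] := ltnP 1 k.
  by apply: (le_trans epsm); apply: maxF; apply: feasible_ppt_fidelities; rewrite ?k1.
have kE : k = 1%N by apply/eqP; rewrite eqn_leq k1.
(* At k = 1 the given m need not yield a PPT [distillation_map]; m = 1 replaces it, with value 1 >=
   1 - eps. *)
apply: (@le_trans _ _ 1); first by rewrite gerBl; case/andP: eps01 => /ltW.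
apply: maxF; rewrite -program_value1; apply: feasible_ppt_fidelities => //.
  by apply/orP; right; apply/forallP => i; rewrite eqxx.
by rewrite kE invr1; exact: feasible1.
Qed.

(** Dimension 1 is always reached, by m = 1. For a reached dimension k every m_i is at most d^n / k,
    hence 1 - eps <= d^n / k, which bounds k because eps < 1. *)
Lemma has_max_ppt_distillable_dims : has_max (ppt_distillable_dims eps rho).
Proof.
have [e0 e1] := andP eps01.
apply: (@has_max_nat _ (Num.truncn (d%:R ^+ n / (1 - eps)))).
  exists 1%N; apply/ppt_distillable_dimsP; split=> //.
  exists (fun=> 1); rewrite invr1 program_value1; split; first exact: feasible1.
  by rewrite gerBl ltW.
move=> k /ppt_distillable_dimsP[k_gt0 [m [[m01 mk] epsm]]].
have k0 : 0 < k%:R :> R by rewrite ltr0n.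
have mle i : m i <= d%:R ^+ n * k%:R^-1.
  by have [s <-] := weight_surj i; exact: (le_exp_of_iso_coef d_gt1 mk).
have := le_trans epsm (program_value_le mle).
rewrite ler_pdivlMr // mulrC -ler_pdivlMr ?subr_gt0 // => kle.
by rewrite truncn_ge_nat // divr_ge0 ?exprn_ge0 // subr_ge0 ltW.
Qed.

End LinearProgram.

Theorem proposition11 (R : realType) (d n : nat) (F eps : R)
  (hd : (2 <= d)%N) (hF : 0 <= F <= 1) (hn : (1 <= n)%N) (heps : 0 < eps < 1) :
  let rho := tensor_power n (isotropic d F) in
  let lp_values : set int := [set v | exists (eta : R) (m : 'I_n.+1 -> R),
    [/\ forall i, 0 <= m i <= 1,
        1 - eps <= \sum_(i < n.+1) 'C(n, i)%:R * F ^+ i * (1 - F) ^+ (n - i) * m i,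
        forall k : 'I_n.+1,
          - eta <= \sum_(i < n.+1) iso_coef d n i k * m i <= eta
      & v = Num.floor (1 / eta)]] in
  (* the maxima are attained *)
  [/\ forall k : nat, (1 <= k)%N -> has_max (ppt_fidelities rho k),
      has_max (ppt_distillable_dims eps rho),
      has_max lp_values
    & E_D_PPT eps rho = log2 (max_val 0 lp_values)%:~R].
Proof.
move=> rho lp_values.
have maxD := has_max_ppt_distillable_dims n hd hF heps.
have [Dk maxk] := max_valP 0%N maxD; set k := max_val 0%N _ in Dk maxk.
have dimsP := @ppt_distillable_dimsP R d n F eps hd hF heps.
have maxlp : is_max lp_values k%:Z.
  split.
    have /dimsP[k_gt0 [m [[m01 mk] epsm]]] := Dk.
    (* At eta = 1 / k the floor is k itself. *)
    exists k%:R^-1, m; split=> //; first by move=> j; rewrite -ler_norml.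
    by rewrite div1r invrK; exact/esym/(intrKfloor k%:Z).
  move=> v [eta [m [m01 epsm meta vE]]].
  (* Nonpositive values lie below k; they include the one from eta = 0, where 1 / eta is 0 by
     convention. *)
  have [v0|v0] := leP v 0; first by apply: le_trans v0 _.
  have vE' : v = `|v|%N%:Z by rewrite gez0_abs // ltW.
  have absv_gt0 : (0 < `|v|)%N by rewrite -ltz_nat -vE'.
  (* From v <= 1 / eta follows eta <= 1 / v, so the same m is feasible at 1 / v and v is a
     distillable dimension. *)
  rewrite vE' lez_nat; apply: maxk; apply/dimsP; split=> //.
  exists m; split=> //; split=> // j; rewrite ler_norml.
  have vr0 : 0 < `|v|%N%:R :> R by rewrite ltr0n.
  have v_le : `|v|%N%:R <= 1 / eta.
    by have := floor_le (1 / eta); rewrite -vE vE'.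
  have eta0 : 0 < eta.
    by have := lt_le_trans vr0 v_le; rewrite div1r invr_gt0.
  have eta_le : eta <= `|v|%N%:R^-1.
    by move: v_le; rewrite ler_pdivlMr // mulrC -ler_pdivlMr // div1r.
  have /andP[m1 m2] := meta j.
  by rewrite (le_trans m2) // andbT (le_trans _ m1) // lerN2.
split=> //; [exact: has_max_ppt_fidelities|by exists k%:Z|].
by rewrite (max_valE 0 maxlp).
Qed.
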